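(* Let $\Bbbk$ be an algebraically closed field of characteristic $2$, and let $X\subset\mathbb{P}^3$ be the Kummer quartic surface associated with an ordinary curve of genus $2$. Then the bitangent surface $\mathrm{Bit}(X)$ is of bidegree $(m,n)=(3,7)$ in $G_1(\mathbb{P}^3)$. It consists of seven irreducible components: three of bidegree $(1,1)$, corresponding to three bitangent involutions of $X$, and four of bidegree $(0,1)$, corresponding to the four tropes of $X$.
   Context: $G_1(\mathbb{P}^3)$ is the Grassmannian of lines in $\mathbb{P}^3$. A congruence of lines is a surface $F\subset G_1(\mathbb{P}^3)$. Its bidegree is $(m,n)$, where the order $m$ is the number of lines of $F$ through a general point of $\mathbb{P}^3$ and the class $n$ is the number of lines of $F$ contained in a general plane. A line $\ell$ is a bitangent line of a normal surface $X\subset\mathbb{P}^3$ if either $\ell\subset X$, or $X$ cuts out on $\ell$ a divisor $2a+2b+D'$ with $D'$ effective ($a=b$ allowed). $\mathrm{Bit}(X)\subset G_1(\mathbb{P}^3)$ is the variety of bitangent lines of $X$. The Kummer quartic surface associated with a smooth genus $2$ curve $C$ is the quotient $J(C)/(\iota)$ of the Jacobian by the negation involution, embedded in $\mathbb{P}^3$ as a quartic surface. A genus $2$ curve in characteristic $2$ is ordinary if $J(C)$ has four $2$-torsion points. In this case $X$ is given in suitable coordinates by $$a(x^2y^2+z^2w^2)+b(x^2z^2+y^2w^2)+c(x^2w^2+y^2z^2)+xyzw=0$$ with $a,b,c\in\Bbbk$ non-zero. A trope is a plane cutting $X$ along a double conic; here the tropes are $V(x),V(y),V(z),V(w)$. The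 component of $\mathrm{Bit}(X)$ corresponding to a trope is the $\beta$-plane of all lines contained in it. A bitangent involution of a quartic surface $X$ is a birational involution $\sigma$ of $X$ such that for general $x\in X$ the line $\langle x,\sigma(x)\rangle$ is a bitangent line of $X$ (tangent at $x$ and $\sigma(x)$). The corresponding component of $\mathrm{Bit}(X)$ is the closure $S(\sigma)$ of the set of lines $\langle x,\sigma(x)\rangle$. *)

(* Defs.v *)
From HB Require Import structures.
From mathcomp Require Import all_boot all_order all_algebra.
From mathcomp Require Import mpoly.

Set Implicit Arguments.
Unset Strict Implicit.
Unset Printing Implicit Defensive.

Import GRing.Theory.
Local Open Scope ring_scope.

(* P^3 is the space of lines through 0 in the row vectors 'rV[k]_4: a point is
   a nonzero vector up to scaling, a line (resp. plane) is a subspace of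
   dimension 2 (resp. 3).  A surface in P^3 is given by a form F. *)

Section Forms.
Context {k : fieldType}.

Definition evalv n (F : {mpoly k[n]}) (v : 'rV[k]_n) : k :=
  F.@[fun i => v 0 i].

(* The pullback of F along the linear map v |-> v *m M. *)
Definition pullback m n (M : 'M[k]_(m, n)) (F : {mpoly k[n]}) : {mpoly k[m]} :=
  F \mPo [tuple \sum_(i < m) M i j *: 'X_i | j < n].

(* When \dim U = m, the rows are a basis of U. *)
Definition basis_mx m n (U : {vspace 'rV[k]_n}) : 'M[k]_(m, n) :=
  \matrix_(i < m) (vbasis U)`_i.

Definition is_line (L : {vspace 'rV[k]_4}) : Prop := \dim L = 2%N.

Definition is_plane (P : {vspace 'rV[k]_4}) : Prop := \dim P = 3%N.

Definition plane_of (h : 'rV[k]_4) : {vspace 'rV[k]_4} :=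
  lker (linfun (mulmxr h^T : 'rV[k]_4 -> 'rV[k]_1)).

(* For a form F, a property holds at a general point of the irreducible
   surface V(F) if it holds on a nonempty open subset of V(F). *)
Definition general_on (F : {mpoly k[4]}) (P : 'rV[k]_4 -> Prop) : Prop :=
  exists (d : nat) (g : {mpoly k[4]}),
    [/\ g \is d.-homog,
        exists x, [/\ x != 0, evalv F x = 0 & evalv g x != 0]
      & forall x, x != 0 -> evalv F x = 0 -> evalv g x != 0 -> P x].

(* The same for P^3 and, through plane_of, for its dual; D(g) is nonempty as
   soon as g != 0 when k is infinite. *)
Definition general_point (P : 'rV[k]_4 -> Prop) : Prop :=
  exists (d : nat) (g : {mpoly k[4]}),
    [/\ g \is d.-homog, g != 0
      & forall x, x != 0 -> evalv g x != 0 -> P x].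

End Forms.

Section LineGeometry.
Context {k : fieldType}.

Definition lineset := {vspace 'rV[k]_4} -> Prop.

Definition same_lines (Z W : lineset) : Prop := forall L, Z L <-> W L.

Definition minor2 (M : 'M[k]_(2, 4)) (i j : 'I_4) : k :=
  M 0 i * M 1 j - M 0 j * M 1 i.

(* Plücker coordinates p01, p02, p03, p12, p13, p23.  They depend on the chosen
   basis of L up to a nonzero factor, and are only fed to homogeneous
   polynomials below. *)
Definition plucker (L : {vspace 'rV[k]_4}) : 'rV[k]_6 :=
  let p := minor2 (basis_mx 2 L) in
  \row_i tnth [tuple p 0 1; p 0 2; p 0 3; p 1 2; p 1 3; p 2 3] i.

(* Zariski closed subsets of G_1(P^3). *)
Definition closed_lines (Z : lineset) : Prop :=
  exists S : {mpoly k[6]} -> Prop,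
    (forall f, S f -> exists d : nat, f \is d.-homog) /\
    (forall L, Z L <->
       is_line L /\ (forall f, S f -> evalv f (plucker L) = 0)).

Definition closure_lines (A : lineset) : lineset := fun L =>
  is_line L /\
  forall Z, closed_lines Z -> (forall L', is_line L' -> A L' -> Z L') -> Z L.

Definition irreducible_lines (Z : lineset) : Prop :=
  (exists L, Z L) /\
  forall A B, closed_lines A -> closed_lines B ->
    (forall L, Z L -> A L \/ B L) ->
    (forall L, Z L -> A L) \/ (forall L, Z L -> B L).

Definition irreducible_component (W Z : lineset) : Prop :=
  [/\ closed_lines Z, irreducible_lines Z, (forall L, Z L -> W L)
    & forall Z', closed_lines Z' -> irreducible_lines Z' ->
        (forall L, Z' L -> W L) -> (forall L, Z L -> Z' L) ->
        forall L, Z' L -> Z L].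

Definition meets_hyperplanes (Z : lineset) d (H : 'I_d -> 'rV[k]_6) : Prop :=
  exists L, Z L /\ forall i, plucker L *m (H i)^T = 0.

(* Dimension of a closed subset of P^5, k algebraically closed: it is the d for
   which any d hyperplanes meet the subset, but some d + 1 do not. *)
Definition has_dim (Z : lineset) (d : nat) : Prop :=
  (forall H : 'I_d -> 'rV[k]_6, meets_hyperplanes Z H) /\
  (exists H : 'I_d.+1 -> 'rV[k]_6, ~ meets_hyperplanes Z H).

Definition congruence (Z : lineset) : Prop := closed_lines Z /\ has_dim Z 2.

Definition num_lines (Z : lineset) (n : nat) : Prop :=
  exists s : seq {vspace 'rV[k]_4},
    [/\ uniq s, size s = n & forall L, L \in s <-> Z L].

Definition has_order (Z : lineset) (m : nat) : Prop :=
  general_point (fun p => num_lines (fun L => Z L /\ p \in L) m).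

Definition has_class (Z : lineset) (n : nat) : Prop :=
  general_point (fun h =>
    num_lines (fun L => Z L /\ (L <= plane_of h)%VS) n).

Definition bidegree (Z : lineset) (m n : nat) : Prop :=
  [/\ congruence Z, has_order Z m & has_class Z n].

Definition beta_plane (P : {vspace 'rV[k]_4}) : lineset := fun L =>
  is_line L /\ (L <= P)%VS.

End LineGeometry.

Section Bitangents.
Context {k : fieldType}.

(* The linear form on P^1 vanishing exactly at the point a. *)
Definition point_form (a : 'rV[k]_2) : {mpoly k[2]} :=
  a 0 1 *: 'X_0 - a 0 0 *: 'X_1.

(* On the line parametrized by M, the form F vanishes or cuts out a divisor
   2a + 2b + D' with D' effective. *)
Definition bitangent_at (F : {mpoly k[4]}) (M : 'M[k]_(2, 4)) (a b : 'rV[k]_2)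
    : Prop :=
  exists g : {mpoly k[2]},
    pullback M F = point_form a ^+ 2 * point_form b ^+ 2 * g.

Definition Bit (F : {mpoly k[4]}) : lineset := fun L =>
  is_line L /\
  (pullback (basis_mx 2 L) F = 0 \/
   exists a b, [/\ a != 0, b != 0 & bitangent_at F (basis_mx 2 L) a b]).

(* P cuts out the divisor 2 V(q), with V(q) a conic in P; any scalar factor is
   absorbed in q as k will be algebraically closed. *)
Definition trope (F : {mpoly k[4]}) (P : {vspace 'rV[k]_4}) : Prop :=
  is_plane P /\
  exists q : {mpoly k[3]},
    [/\ q \is 2.-homog, q != 0 & pullback (basis_mx 3 P) F = q ^+ 2].

(* The rational self-map of P^3 with components s; it is undefined where its
   value is the zero vector. *)
Definition ratmap (s : 4.-tuple {mpoly k[4]}) (x : 'rV[k]_4) : 'rV[k]_4 :=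
  \row_i evalv (tnth s i) x.

(* In the basis (x, s x) of the line <x, s x>, the points x and s x have
   coordinates delta_mx 0 0 and delta_mx 0 1. *)
Definition bitangent_involution (F : {mpoly k[4]}) (s : 4.-tuple {mpoly k[4]})
    : Prop :=
  (exists d : nat, forall i, tnth s i \is d.-homog) /\
  general_on F (fun x =>
    let y := ratmap s x in
    [/\ evalv F y = 0,
        exists2 c, c != 0 & ratmap s y = c *: x,
        free [:: x; y]
      & bitangent_at F (col_mx x y) (delta_mx 0 0) (delta_mx 0 1)]).

Definition involution_surface (F : {mpoly k[4]}) (s : 4.-tuple {mpoly k[4]})
    : lineset :=
  closure_lines (fun L => exists x,
    [/\ evalv F x = 0, free [:: x; ratmap s x]
      & L = <<[:: x; ratmap s x]>>%VS]).

End Bitangents.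

Section Kummer.
Context {k : fieldType}.

Definition kummer_form (a b c : k) : {mpoly k[4]} :=
  let x := 'X_(0 : 'I_4) in let y := 'X_(1 : 'I_4) in
  let z := 'X_(2 : 'I_4) in let w := 'X_(3 : 'I_4) in
  a *: (x ^+ 2 * y ^+ 2 + z ^+ 2 * w ^+ 2)
  + b *: (x ^+ 2 * z ^+ 2 + y ^+ 2 * w ^+ 2)
  + c *: (x ^+ 2 * w ^+ 2 + y ^+ 2 * z ^+ 2)
  + x * y * z * w.

(* Over an algebraically closed field of characteristic 2, the Kummer quartics
   of ordinary curves of genus 2 are the quartics with this equation in
   suitable coordinates of P^3; rescaling g also rescales the equation. *)
Definition ordinary_kummer_quartic (F : {mpoly k[4]}) : Prop :=
  exists (a b c : k) (g : 'M[k]_4),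
    [/\ a != 0, b != 0, c != 0, g \in unitmx
      & F = pullback g (kummer_form a b c)].

End Kummer.

(* Main.v *)
(* In characteristic 2 the Kummer form is a combination of squares plus x y z w,
   and a binary quartic form is a square as soon as its partial derivatives
   vanish.  Hence L is bitangent iff the four linear forms x, y, z, w restricted
   to L have a square product: either one of them vanishes on L, that is, L lies
   in a trope, or they are pairwise proportional, that is, L meets two opposite
   edges of the coordinate tetrahedron.  In Plücker coordinates this says that
   the zeros among the p_ij contain either a star p_ij, p_ik, p_il or a pair of
   opposite coordinates p_ij, p_kl: four beta-planes and three congruences of
   bidegree (1,1).  The line of the congruence p_01 = p_23 = 0 through (x,y,z,w)
   joins (x,y,0,0) and (0,0,z,w); it meets X again in (1/y,1/x,1/w,1/z).  The
   other two congruences and the other beta-planes are obtained by permuting the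
   columns of the matrix of coordinates. *)

(* To pass from bitangency to zeros of Plücker coordinates, the derivative of x y z w along L is
   evaluated at the zero of one coordinate form. The coordinates of that point are the p_ji and a
   single term of the derivative survives, so for each index i the product of the three p_ij
   vanishes. These four cubic conditions leave a finite combinatorial problem. A line carries an
   arbitrary basis, so minors are known only up to a nonzero factor, whence the many statements with
   a factor c. Irreducibility and closures are settled on an affine space of parameters, where two
   nonempty open sets meet. The delicate point is that the secants of an involution are dense in its
   congruence: on a general line of the congruence the Kummer form is a quadratic in the squares of
   the parameters, and a zero of it is a point of X that the involution moves along that line.
   Distinctness, both of the components and of the lines counted by order and class, rests on one
   fact: no pattern of forced zeros contains another. *)
Require Import Defs.
From Stdlib Require Import Classical FunctionalExtensionality PropExtensionality.
From mathcomp Require Import all_boot all_order all_algebra all_fingroup.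
From mathcomp Require Import mpoly ring.

Set Implicit Arguments.
Unset Strict Implicit.
Unset Printing Implicit Defensive.

Import GRing.Theory.
Local Open Scope ring_scope.

(** * Polynomial functions *)

Section Polynomials.
Context {k : fieldType}.

Lemma comp_mpolyA (n m r : nat) (p : {mpoly k[n]}) (s : n.-tuple {mpoly k[m]})
    (t : m.-tuple {mpoly k[r]}) :
  (p \mPo s) \mPo t = p \mPo [tuple tnth s i \mPo t | i < n].
Proof.
rewrite (comp_mpolyE p s) (comp_mpolyE p) rmorph_sum /=; apply: eq_bigr => i _.
rewrite comp_mpolyZ; congr (_ *: _).
by rewrite rmorph_prod; apply: eq_bigr => j _; rewrite tnth_mktuple rmorphXn.
Qed.

Lemma pullbackM (l m n : nat) (A : 'M[k]_(l, m)) (B : 'M[k]_(m, n))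
    (F : {mpoly k[n]}) : pullback A (pullback B F) = pullback (A *m B) F.
Proof.
rewrite /pullback comp_mpolyA; congr (_ \mPo _); apply: eq_from_tnth => j.
rewrite !tnth_mktuple raddf_sum /=.
under eq_bigr => i _ do
  rewrite comp_mpolyZ comp_mpolyXU -tnth_nth tnth_mktuple scaler_sumr.
rewrite exchange_big /=; apply: eq_bigr => i _.
by rewrite mxE scaler_suml; apply: eq_bigr => u _; rewrite scalerA mulrC.
Qed.

Lemma pullback1 (n : nat) (F : {mpoly k[n]}) : pullback 1%:M F = F.
Proof.
rewrite -[RHS]comp_mpoly_id /pullback; congr (_ \mPo _).
apply: eq_from_tnth => j; rewrite !tnth_mktuple (bigD1 j) //= mxE eqxx scale1r.
by rewrite big1 ?addr0 // => i /negPf ij; rewrite mxE ij scale0r.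
Qed.

Lemma evalv_pullback (m n : nat) (A : 'M[k]_(m, n)) (F : {mpoly k[n]}) v :
  evalv (pullback A F) v = evalv F (v *m A).
Proof.
rewrite /evalv comp_mpoly_meval; apply: meval_eq => i.
rewrite tnth_mktuple raddf_sum mxE /=; apply: eq_bigr => j _.
by rewrite mevalZ mevalXU mulrC.
Qed.

Lemma evalvM (n : nat) (f g : {mpoly k[n]}) v :
  evalv (f * g) v = evalv f v * evalv g v.
Proof. exact: mevalM. Qed.

Definition meval_simpl := (mevalD, mevalB, mevalN, mevalM, mevalZ, mevalC,
  mevalXU, rmorphXn).

Lemma evalv_homog (n d : nat) (f : {mpoly k[n]}) c v :
  f \is d.-homog -> evalv f (c *: v) = c ^+ d * evalv f v.
Proof.
move=> /dhomogP hf; rewrite /evalv !mevalE mulr_sumr.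
apply: eq_big_seq => m /hf md; rewrite mulrCA; congr (_ * _).
under eq_bigr => i _ do rewrite mxE exprMn.
by rewrite big_split /= prodrXr -(md) /= mdegE.
Qed.

Lemma evalv_homog_eq0 (n d : nat) (f : {mpoly k[n]}) c v :
  f \is d.-homog -> c != 0 -> (evalv f (c *: v) == 0) = (evalv f v == 0).
Proof.
by move=> hf c0; rewrite (evalv_homog _ _ hf) mulf_eq0 expf_eq0 (negPf c0) andbF.
Qed.

(** Polynomiality is kept as a property of functions, so that genericity arguments can substitute
    pointwise without naming polynomials. *)
Definition polyfun n (f : 'rV[k]_n -> k) :=
  exists p : {mpoly k[n]}, forall v, f v = evalv p v.

Lemma polyfun_coord n i : polyfun (fun v : 'rV[k]_n => v 0 i).
Proof. by exists 'X_i => v; rewrite /evalv mevalXU. Qed.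

Lemma polyfun_const n c : polyfun (fun _ : 'rV[k]_n => c).
Proof. by exists c%:MP => v; rewrite /evalv mevalC. Qed.

Lemma polyfunD n (f g : 'rV[k]_n -> k) :
  polyfun f -> polyfun g -> polyfun (fun v => f v + g v).
Proof.
by move=> [p pf] [q qg]; exists (p + q) => v; rewrite pf qg /evalv mevalD.
Qed.

Lemma polyfunM n (f g : 'rV[k]_n -> k) :
  polyfun f -> polyfun g -> polyfun (fun v => f v * g v).
Proof.
by move=> [p pf] [q qg]; exists (p * q) => v; rewrite pf qg /evalv mevalM.
Qed.

Lemma polyfun_sum n (I : finType) (f : I -> 'rV[k]_n -> k) :
  (forall i, polyfun (f i)) -> polyfun (fun v => \sum_i f i v).
Proof.
move=> pf; rewrite unlock /reducebig /=.
elim: (index_enum I) => [|i r IH] /=; first exact: polyfun_const.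
exact: polyfunD.
Qed.

Lemma polyfun_mulmx m n r (f : 'rV[k]_m -> 'M[k]_(n, r)) s (A : 'M[k]_(r, s)) :
  (forall i j, polyfun (fun v => f v i j)) ->
  forall i j, polyfun (fun v => (f v *m A) i j).
Proof.
move=> pf i j.
have [p pP] : polyfun (fun v => \sum_l f v i l * A l j).
  by apply: polyfun_sum => l; apply: polyfunM => //; exact: polyfun_const.
by exists p => v; rewrite -pP mxE.
Qed.

Lemma polyfun_comp m n (f : 'rV[k]_n -> k) (phi : 'rV[k]_m -> 'rV[k]_n) :
  polyfun f -> (forall i, polyfun (fun v => phi v 0 i)) ->
  polyfun (fun v => f (phi v)).
Proof.
move=> [p pf] pphi.
have /fin_all_exists[q qP] := pphi.
exists (p \mPo [tuple q i | i < n]) => v.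
rewrite pf /evalv comp_mpoly_meval; apply: meval_eq => i.
by rewrite tnth_mktuple qP.
Qed.

Lemma polyfun_line n (f : 'rV[k]_n -> k) (u d : 'rV[k]_n) :
  polyfun f -> exists P : {poly k}, forall s, f (u + s *: d) = P.[s].
Proof.
move=> [p pf].
exists (mmap polyC (fun i => (u 0 i)%:P + d 0 i *: 'X) p) => s.
rewrite pf /evalv mevalE /mmap horner_sum; apply: eq_bigr => m _.
rewrite hornerM hornerC horner_prod; congr (_ * _); apply: eq_bigr => i _.
by rewrite horner_exp !hornerE !mxE mulrC.
Qed.

End Polynomials.

Section ClosedField.
Context {k : closedFieldType}.

(** This is the irreducibility of affine space: on the line through u and v both functions become
    nonzero univariate polynomials, and their product has a non-root. *)
Lemma polyfun_meet n (f g : 'rV[k]_n -> k) u v :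
  polyfun f -> polyfun g -> f u != 0 -> g v != 0 ->
  exists w, f w != 0 /\ g w != 0.
Proof.
move=> pf pg fu gv.
have [P fP] := polyfun_line u (v - u) pf.
have [Q gQ] := polyfun_line u (v - u) pg.
have P0 : P != 0.
  apply: contraNneq fu => P0.
  by rewrite -[u]addr0 -(scale0r (v - u)) fP P0 horner0.
have Q0 : Q != 0.
  apply: contraNneq gv => Q0.
  by rewrite -(subrK u v) addrC -[v - u]scale1r gQ Q0 horner0.
have [s] := closed_nonrootP (P * Q) (mulf_neq0 P0 Q0).
rewrite rootE hornerM mulf_eq0 negb_or -fP -gQ => /andP[].
by exists (u + s *: (v - u)).
Qed.

Lemma sqrt_exists (c : k) : exists r : k, r ^+ 2 = c.
Proof.
have /closed_rootP[x] : size ('X^2 - c%:P) != 1 by rewrite size_XnsubC.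
by rewrite rootE !hornerE subr_eq0 => /eqP; exists x.
Qed.

(** These are the coefficients in A X^2 + B X Y + C Y^2 = (p X + q Y)(r X + s Y). For A nonzero, the
    second factor is X - x Y for a root x and the first is the quotient. *)
Lemma quadratic_factor (A B C : k) :
  exists p q r s : k, [/\ A = p * r, B = p * s + q * r & C = q * s].
Proof.
have [->|A0] := eqVneq A 0.
  by exists 0, 1, B, C; split; ring.
have /closed_rootP[x] : size (A *: 'X^2 + B *: 'X + C%:P) != 1.
  rewrite -addrA size_polyDl size_scale // size_polyXn // ltnS.
  rewrite (leq_trans (size_polyD _ _)) // geq_max.
  rewrite (leq_trans (size_scale_leq _ _)) ?size_polyX //.
  by rewrite (leq_trans (size_polyC_leq1 _)).
rewrite rootE !(hornerD, hornerZ, hornerXn, hornerX, hornerC) => /eqP rx.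
exists A, (B + A * x), 1, (- x); split; try ring.
apply/eqP; rewrite -subr_eq0 -rx; apply/eqP; ring.
Qed.

End ClosedField.

(** * Plücker coordinates *)

Section Coordinates.
Context {k : fieldType}.

Lemma sum2E (V : nmodType) (F : 'I_2 -> V) : \sum_i F i = F 0 + F 1.
Proof.
by rewrite !big_ord_recl big_ord0 addr0; congr (_ + F _); apply: val_inj.
Qed.

Lemma sum4E (V : nmodType) (F : 'I_4 -> V) :
  \sum_i F i = F 0 + F 1 + F 2 + F 3.
Proof.
rewrite !big_ord_recl big_ord0 addr0 !addrA.
by congr (_ + F _ + F _ + F _); apply: val_inj.
Qed.

Lemma forall2P (P : 'I_2 -> Prop) : P 0 -> P 1 -> forall i, P i.
Proof.
move=> P0 P1 [[|[|i]] Hi] //.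
- by rewrite (_ : Ordinal Hi = 0) //; apply: val_inj.
- by rewrite (_ : Ordinal Hi = 1) //; apply: val_inj.
Qed.

Lemma forall4P (P : 'I_4 -> Prop) : P 0 -> P 1 -> P 2 -> P 3 -> forall i, P i.
Proof.
move=> P0 P1 P2 P3 [[|[|[|[|i]]]] Hi] //.
- by rewrite (_ : Ordinal Hi = 0) //; apply: val_inj.
- by rewrite (_ : Ordinal Hi = 1) //; apply: val_inj.
- by rewrite (_ : Ordinal Hi = 2) //; apply: val_inj.
- by rewrite (_ : Ordinal Hi = 3) //; apply: val_inj.
Qed.

Definition row4 (a b c d : k) : 'rV[k]_4 := \row_i tnth [tuple a; b; c; d] i.

Lemma row4E (a b c d : k) : (row4 a b c d 0 0 = a) * (row4 a b c d 0 1 = b) *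
  (row4 a b c d 0 2 = c) * (row4 a b c d 0 3 = d).
Proof. by rewrite !mxE. Qed.

Lemma row4_eta (v : 'rV[k]_4) : v = row4 (v 0 0) (v 0 1) (v 0 2) (v 0 3).
Proof. by apply/rowP; apply: forall4P; rewrite row4E. Qed.

Definition row6 (a b c d e f : k) : 'rV[k]_6 :=
  \row_i tnth [tuple a; b; c; d; e; f] i.

Definition minor6 (M : 'M[k]_(2, 4)) : 'rV[k]_6 :=
  row6 (minor2 M 0 1) (minor2 M 0 2) (minor2 M 0 3)
       (minor2 M 1 2) (minor2 M 1 3) (minor2 M 2 3).

Lemma row6E (a b c d e f : k) (r := row6 a b c d e f) :
  (r 0 (inord 0) = a) * (r 0 (inord 1) = b) * (r 0 (inord 2) = c) *
  (r 0 (inord 3) = d) * (r 0 (inord 4) = e) * (r 0 (inord 5) = f).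
Proof. by rewrite !mxE !(tnth_nth 0) !inordK. Qed.

Lemma row6_inj (a b c d e f a' b' c' d' e' f' : k) :
  row6 a b c d e f = row6 a' b' c' d' e' f' ->
  [/\ a = a', b = b' & c = c'] /\ [/\ d = d', e = e' & f = f'].
Proof.
move=> E; pose r i := congr1 (fun v : 'rV[k]_6 => v 0 (inord i)) E.
by move: (r 0%N) (r 1%N) (r 2%N) (r 3%N) (r 4%N) (r 5%N); rewrite !row6E.
Qed.

Lemma row6Z (t a b c d e f : k) :
  t *: row6 a b c d e f = row6 (t * a) (t * b) (t * c) (t * d) (t * e) (t * f).
Proof.
apply/rowP => i; rewrite !mxE !(tnth_nth 0).
by case: i => [[|[|[|[|[|[|i]]]]]] Hi].
Qed.

Lemma row6_0 : row6 0 0 0 0 0 0 = 0.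
Proof.
apply/rowP => i; rewrite !mxE !(tnth_nth 0).
by case: i => [[|[|[|[|[|[|i]]]]]] Hi].
Qed.

Lemma row6_eta (v : 'rV[k]_6) :
  exists a b c d e f, v = row6 a b c d e f.
Proof.
exists (v 0 (inord 0)), (v 0 (inord 1)), (v 0 (inord 2)), (v 0 (inord 3)),
  (v 0 (inord 4)), (v 0 (inord 5)).
apply/rowP => i; rewrite !mxE !(tnth_nth 0).
by case: i => [[|[|[|[|[|[|i]]]]]] Hi] //=; congr (v _ _); apply: val_inj;
  rewrite /= inordK.
Qed.

Lemma row6_dot (a b c d e f a' b' c' d' e' f' : k) :
  row6 a b c d e f *m (row6 a' b' c' d' e' f')^T =
  (a * a' + b * b' + c * c' + d * d' + e * e' + f * f')%:M.
Proof.
apply/matrixP => i j; rewrite !ord1 !mxE eqxx mulr1n.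
by rewrite !big_ord_recl big_ord0 addr0 !addrA !mxE !(tnth_nth 0).
Qed.

Definition rows2 (g : 'M[k]_4) (p : 'I_4 * 'I_4) : 'M[k]_(2, 4) :=
  \matrix_(i, j) (if i == 0 then g p.1 j else g p.2 j).

(* The second exterior power, in the order of the Plücker coordinates. *)
Definition wedge (g : 'M[k]_4) : 'M[k]_6 :=
  \matrix_(i < 6) minor6 (rows2 g (tnth [tuple (0, 1); (0, 2); (0, 3);
                                              (1, 2); (1, 3); (2, 3)] i)).

(** Cauchy-Binet for 2 x 2 minors. *)
Lemma minor2_mulmx (M : 'M[k]_(2, 4)) (g : 'M[k]_4) i j :
  minor2 (M *m g) i j =
    minor2 M 0 1 * minor2 (rows2 g (0, 1)) i j +
    minor2 M 0 2 * minor2 (rows2 g (0, 2)) i j +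
    minor2 M 0 3 * minor2 (rows2 g (0, 3)) i j +
    minor2 M 1 2 * minor2 (rows2 g (1, 2)) i j +
    minor2 M 1 3 * minor2 (rows2 g (1, 3)) i j +
    minor2 M 2 3 * minor2 (rows2 g (2, 3)) i j.
Proof. by rewrite /minor2 !mxE !sum4E /=; ring. Qed.

Lemma minor6_mulmx (M : 'M[k]_(2, 4)) (g : 'M[k]_4) :
  minor6 (M *m g) = minor6 M *m wedge g.
Proof.
apply/rowP => i; rewrite [RHS]mxE !big_ord_recl big_ord0 addr0 !addrA.
rewrite !mxE !(tnth_nth 0) /=.
by case: i => [[|[|[|[|[|[|i]]]]]] Hi] //=; exact: minor2_mulmx.
Qed.

Lemma rows2M (g h : 'M[k]_4) p : rows2 (g *m h) p = rows2 g p *m h.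
Proof.
by apply/matrixP => i j; rewrite !mxE; case: ifP => i0; apply: eq_bigr => l _;
  rewrite !mxE i0.
Qed.

Lemma wedgeM (g h : 'M[k]_4) : wedge (g *m h) = wedge g *m wedge h.
Proof.
by apply/row_matrixP => i; rewrite row_mul !rowK -minor6_mulmx rows2M.
Qed.

Lemma wedge1 : wedge 1%:M = 1%:M.
Proof.
apply/matrixP => i j; rewrite !mxE !(tnth_nth 0).
by case: i => [[|[|[|[|[|[|i]]]]]] Hi] //=;
  case: j => [[|[|[|[|[|[|j]]]]]] Hj] //=; rewrite /minor2 !mxE /= ; ring.
Qed.

Lemma wedgeK (g : 'M[k]_4) : g \in unitmx ->
  wedge g *m wedge (invmx g) = 1%:M.
Proof. by move=> gu; rewrite -wedgeM mulmxV // wedge1. Qed.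

(** The factor is det A: a change of basis of a line only rescales its minors. *)
Lemma minor6_mull (A : 'M[k]_2) (M : 'M[k]_(2, 4)) :
  minor6 (A *m M) = (A 0 0 * A 1 1 - A 0 1 * A 1 0) *: minor6 M.
Proof.
have E i j : minor2 (A *m M) i j =
    (A 0 0 * A 1 1 - A 0 1 * A 1 0) * minor2 M i j.
  by rewrite /minor2 !mxE !sum2E; ring.
by rewrite row6Z /minor6 !E.
Qed.

Lemma minor2xx (M : 'M[k]_(2, 4)) i : minor2 M i i = 0.
Proof. by rewrite /minor2 mulrC subrr. Qed.

Lemma minor2C (M : 'M[k]_(2, 4)) i j : minor2 M i j = - minor2 M j i.
Proof. by rewrite /minor2 opprB. Qed.

Lemma minor6_eq0 (M : 'M[k]_(2, 4)) :
  minor6 M = 0 -> forall i j, minor2 M i j = 0.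
Proof.
rewrite -row6_0 => /row6_inj[[m01 m02 m03] [m12 m13 m23]].
by apply: forall4P; apply: forall4P; rewrite ?minor2xx // minor2C
  ?(m01, m02, m03, m12, m13, m23) ?oppr0 // minor2C
  ?(m01, m02, m03, m12, m13, m23) ?oppr0.
Qed.

Lemma plucker_relation (M : 'M[k]_(2, 4)) :
  minor2 M 0 1 * minor2 M 2 3 - minor2 M 0 2 * minor2 M 1 3
  + minor2 M 0 3 * minor2 M 1 2 = 0.
Proof. by rewrite /minor2; ring. Qed.

Lemma col_mx2E m (u v : 'rV[k]_m) j :
  ((col_mx u v : 'M_(2, m)) 0 j = u 0 j) * ((col_mx u v : 'M_(2, m)) 1 j = v 0 j).
Proof.
split.
  by rewrite -(col_mxEu u v 0 j); congr (_ _ _); apply: val_inj.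
by rewrite -(col_mxEd u v 0 j); congr (_ _ _); apply: val_inj.
Qed.

End Coordinates.

(** * Lines, their bases and their minors *)

Section Lines.
Context {k : fieldType}.

Lemma free2P n (u v : 'rV[k]_n) :
  reflect (forall a b, a *: u + b *: v = 0 -> a = 0 /\ b = 0)
    (free [:: u; v]).
Proof.
apply: (iffP (freeP (X := [tuple u; v]))) => [fr a b ab0|fr c].
  have := fr (fun i => if i == 0 then a else b).
  by rewrite sum2E /= => /(_ ab0) ab; split; [exact: (ab 0) | exact: (ab 1)].
rewrite sum2E /= => /fr[c0 c1] [[|[|i]] Hi] //.
  by rewrite -c0; congr c; apply: val_inj.
by rewrite -c1; congr c; apply: val_inj.
Qed.

(** If all minors vanish, then v_i u = u_i v for every i, and freeness forces u = 0. Conversely,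
    given a u + b v = 0, both a and b kill every minor (Cramer). *)
Lemma free_minor6 (u v : 'rV[k]_4) :
  free [:: u; v] <-> minor6 (col_mx u v) != 0.
Proof.
split=> [/free2P fr|m0].
  apply/eqP => /minor6_eq0 m0.
  have uE i : (v 0 i) *: u - (u 0 i) *: v = 0.
    apply/rowP => j; rewrite !mxE; have := m0 j i.
    by rewrite /minor2 !col_mx2E [v 0 i * _]mulrC.
  have u0 : u = 0.
    apply/rowP => i; have := uE i; rewrite -scaleNr => /fr[_ /eqP].
    by rewrite oppr_eq0 mxE => /eqP.
  have := fr 1 0; rewrite u0 scaler0 scale0r addr0 => /(_ erefl)[/eqP].
  by rewrite oner_eq0.
apply/free2P => a b ab0.
have E i j : a * minor2 (col_mx u v) i j = 0 /\ b * minor2 (col_mx u v) i j = 0.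
  have ei := congr1 (fun w : 'rV_4 => w 0 i) ab0.
  have ej := congr1 (fun w : 'rV_4 => w 0 j) ab0.
  rewrite !mxE in ei ej; rewrite /minor2 !col_mx2E; split.
    transitivity ((a * u 0 i + b * v 0 i) * v 0 j
      - (a * u 0 j + b * v 0 j) * v 0 i); first by ring.
    by rewrite ei ej !mul0r subrr.
  transitivity ((a * u 0 j + b * v 0 j) * u 0 i
      - (a * u 0 i + b * v 0 i) * u 0 j); first by ring.
  by rewrite ei ej !mul0r subrr.
have absurd c : c != 0 -> ~ (forall i j, c * minor2 (col_mx u v) i j = 0).
  move=> c0 cm; case/eqP: m0; rewrite -row6_0 /minor6.
  have m00 i j : minor2 (col_mx u v) i j = 0.
    by have /eqP := cm i j; rewrite mulf_eq0 (negPf c0) => /eqP.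
  by rewrite !m00.
split; [have [//|c0] := eqVneq a 0 | have [//|c0] := eqVneq b 0];
  by case: (absurd _ c0) => i j; have [] := E i j.
Qed.

Lemma span2P n (u v w : 'rV[k]_n) :
  reflect (exists a b, w = a *: u + b *: v) (w \in <<[:: u; v]>>%VS).
Proof.
rewrite span_cons span_seq1; apply: (iffP memv_addP).
  by move=> [x /vlineP[a ->]] [y /vlineP[b ->] ->]; exists a, b.
move=> [a [b ->]]; exists (a *: u); first exact: memvZ (memv_line u).
by exists (b *: v); first exact: memvZ (memv_line v).
Qed.

Lemma is_line_span (u v : 'rV[k]_4) :
  free [:: u; v] -> is_line <<[:: u; v]>>%VS.
Proof. by rewrite /is_line /free => /eqP. Qed.

Lemma line_span (L : {vspace 'rV[k]_4}) u v :
  is_line L -> u \in L -> v \in L -> free [:: u; v] -> L = <<[:: u; v]>>%VS.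
Proof.
move=> dL uL vL fr; apply/esym/eqP; rewrite eqEdim dL is_line_span // leqnn.
by rewrite andbT; apply/span_subvP => w; rewrite !inE => /orP[]/eqP->.
Qed.

Lemma memv_basis_mx m n (U : {vspace 'rV[k]_n}) w : \dim U = m ->
  reflect (exists c : 'rV[k]_m, w = c *m basis_mx m U) (w \in U).
Proof.
move=> dU; have bE (c : 'rV_m) :
    c *m basis_mx m U = \sum_i c 0 i *: (vbasis U)`_i.
  by rewrite mulmx_sum_row; apply: eq_bigr => i _; rewrite rowK.
case: m / dU bE => bE; apply: (iffP idP) => [wU|[c ->]].
  exists (\row_i coord (vbasis U) i w); rewrite bE {1}(coord_vbasis wU).
  by apply: eq_bigr => i _; rewrite mxE.
by rewrite bE; apply: memv_suml => i _; rewrite memvZ // vbasis_mem // mem_nth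
  // size_tuple.
Qed.

Lemma basis_mx_free m n (U : {vspace 'rV[k]_n}) (c : 'rV[k]_m) : \dim U = m ->
  c *m basis_mx m U = 0 -> c = 0.
Proof.
move=> dU; case: m / dU c => c cB; apply/rowP => i; rewrite mxE.
have /freeP/(_ (fun i => c 0 i)) := basis_free (vbasisP U); apply.
by rewrite -[RHS]cB mulmx_sum_row; apply: eq_bigr => j _; rewrite rowK.
Qed.

Lemma span_minor6 (u v : 'rV[k]_4) (L := <<[:: u; v]>>%VS) : free [:: u; v] ->
  exists2 c, c != 0 & minor6 (col_mx u v) = c *: plucker L.
Proof.
move=> fr; have dL := is_line_span fr.
have /(memv_basis_mx _ dL)[a aE] : u \in L by rewrite memv_span // inE eqxx.
have /(memv_basis_mx _ dL)[b bE] : v \in L.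
  by rewrite memv_span // !inE eqxx orbT.
have E : col_mx u v = (col_mx a b : 'M_2) *m basis_mx 2 L.
  by rewrite (@mul_col_mx _ 1 1) -aE -bE.
have EE := minor6_mull (col_mx a b : 'M_2) (basis_mx 2 L).
eexists; last by rewrite E; exact: EE.
have := (free_minor6 u v).1 fr; apply: contraNneq => d0.
by rewrite E EE d0 scale0r.
Qed.

(** The stored basis of L, written in the frame where X has the Kummer equation. *)
Definition coordL (g : 'M[k]_4) (L : {vspace 'rV[k]_4}) : 'M[k]_(2, 4) :=
  basis_mx 2 L *m g.

Lemma minor6_coordL g L : minor6 (coordL g L) = plucker L *m wedge g.
Proof. exact: minor6_mulmx. Qed.

Lemma span_minor6_coordL g (u v : 'rV[k]_4) (L := <<[:: u; v]>>%VS) :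
  free [:: u; v] -> exists2 c, c != 0 &
    minor6 (col_mx (u *m g) (v *m g)) = c *: minor6 (coordL g L).
Proof.
move=> /span_minor6[c c0 cE]; exists c => //.
by rewrite minor6_coordL scalemxAl -cE -minor6_mulmx (@mul_col_mx _ 1 1).
Qed.

Lemma coordL_rows g L : is_line L -> exists u v,
  [/\ free [:: u; v], L = <<[:: u; v]>>%VS
    & coordL g L = col_mx (u *m g) (v *m g)].
Proof.
move=> dL; pose u := row 0 (basis_mx 2 L); pose v := row 1 (basis_mx 2 L).
have uvE : basis_mx 2 L = col_mx u v.
  apply/matrixP => i j; move: i; apply: forall2P;
  by rewrite col_mx2E [RHS]mxE.
have fr : free [:: u; v].
  apply/free2P => a b ab0; pose c : 'rV[k]_2 := \row_i (if i == 0 then a else b).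
  have c0 : c = 0.
    apply: (basis_mx_free dL).
    by rewrite mulmx_sum_row sum2E !mxE; exact: ab0.
  by split; [have := congr1 (fun c : 'rV_2 => c 0 0) c0
    | have := congr1 (fun c : 'rV_2 => c 0 1) c0]; rewrite !mxE.
have inL i : row i (basis_mx 2 L) \in L.
  by apply/(memv_basis_mx _ dL); exists (delta_mx 0 i); rewrite rowE.
exists u, v; split => //; first exact: line_span dL (inL 0) (inL 1) fr.
by rewrite /coordL uvE (@mul_col_mx _ 1 1).
Qed.

Lemma free_mulmx (g : 'M[k]_4) (u v : 'rV[k]_4) : g \in unitmx ->
  free [:: u; v] -> free [:: u *m g; v *m g].
Proof.
move=> gu /free2P fr; apply/free2P => a b.
rewrite !scalemxAl -mulmxDl => /(congr1 (mulmxr (invmx g))).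
by rewrite /= mulmxK // mul0mx; exact: fr.
Qed.

Lemma coordL_neq0 (g : 'M[k]_4) L :
  g \in unitmx -> is_line L -> minor6 (coordL g L) != 0.
Proof.
move=> gu /(coordL_rows g)[u [v [fr _ ->]]]; apply/free_minor6.
exact: free_mulmx.
Qed.

End Lines.

Section Homogeneous.
Context {k : fieldType}.

Lemma dhomog_pullback (m n d : nat) (A : 'M[k]_(m, n)) (F : {mpoly k[n]}) :
  F \is d.-homog -> pullback A F \is d.-homog.
Proof.
move=> /dhomogP hF; rewrite /pullback comp_mpolyE big_seq rpred_sum // => u uF.
apply: rpredZ; rewrite -(hF u uF) /= mdegE.
elim/big_ind2: _ => [|? p ? q hp hq|i _]; first exact: dhomog1.
  exact: dhomogM.
rewrite tnth_mktuple; set l := \sum_(j < m) _.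
have hl : l \is 1.-homog.
  by apply: rpred_sum => j _; apply: rpredZ; rewrite dhomogX /= mdeg1.
by have := dhomogMn (u i) hl; rewrite mul1n.
Qed.

Lemma msize_homog (n d : nat) (p : {mpoly k[n]}) :
  p \is d.-homog -> p != 0 -> msize p = d.+1.
Proof.
move=> hp p0; rewrite (dhomog_uniq p0 hp (dhomog_msize hp)) prednK //.
by rewrite lt0n msize_poly_eq0.
Qed.

Lemma kummer_form_homog (a b c : k) : kummer_form a b c \is 4.-homog.
Proof.
have X1 i : ('X_i : {mpoly k[4]}) \is 1.-homog by rewrite dhomogX /= mdeg1.
have X2 i : ('X_i : {mpoly k[4]}) ^+ 2 \is 2.-homog by exact: (dhomogMn 2 (X1 i)).
have X4 i j : ('X_i : {mpoly k[4]}) ^+ 2 * 'X_j ^+ 2 \is 4.-homog.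
  exact: (dhomogM (X2 i) (X2 j)).
do ?[apply: rpredD; try (by apply: rpredZ; apply: rpredD)].
by apply: (@dhomogM _ _ _ 3 _ 1) => //; apply: (@dhomogM _ _ _ 2 _ 1) => //;
  apply: (@dhomogM _ _ _ 1 _ 1).
Qed.

Lemma point_form_homog (a : 'rV[k]_2) : point_form a \is 1.-homog.
Proof. by rewrite rpredB // rpredZ // dhomogX /= mdeg1. Qed.

Lemma point_form_neq0 (a : 'rV[k]_2) : a != 0 -> point_form a != 0.
Proof.
move=> /eqP a0; apply/eqP => pa0; apply: a0.
have E x : evalv (point_form a) x = 0 by rewrite pa0 /evalv meval0.
have := E (delta_mx 0 0); have := E (delta_mx 0 1).
rewrite /evalv !meval_simpl !mxE /= !mulr1 !mulr0 subr0 sub0r => /eqP.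
rewrite oppr_eq0 => /eqP a0 a1; apply/rowP; apply: forall2P;
by rewrite mxE.
Qed.

End Homogeneous.

(** * The Kummer form in characteristic 2 *)

Section Char2.
Context {R : comNzRingType} (R2 : 2%N \in [pchar R]).

Lemma sqrrD_char2 (x y : R) : (x + y) ^+ 2 = x ^+ 2 + y ^+ 2.
Proof. by rewrite sqrrD mulr2n addrr_pchar2 // addr0. Qed.

End Char2.

Section Pullback.
Context {k : fieldType} (k2 : 2%N \in [pchar k]).

Lemma mpoly_char2 n : 2%N \in [pchar {mpoly k[n]}].
Proof. exact: (rmorph_pchar (@mpolyC n k)). Qed.

Definition linf m (N : 'M[k]_(m, 4)) i : {mpoly k[m]} :=
  \sum_d N d i *: 'X_d.

Lemma evalv_linf m (N : 'M[k]_(m, 4)) i v : evalv (linf N i) v = (v *m N) 0 i.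
Proof.
rewrite /evalv raddf_sum mxE /=; apply: eq_bigr => d _.
by rewrite !meval_simpl mulrC.
Qed.

Lemma mderiv_linf m (N : 'M[k]_(m, 4)) i d : (linf N i)^`M(d) = (N d i)%:MP.
Proof.
rewrite raddf_sum (bigD1 d) //= big1 => [|e /negPf ed].
  rewrite mderivZ mderivX mnm1E eqxx scale1r addr0 -mul_mpolyC.
  rewrite (_ : (_ - _)%MM = 0%MM) ?mpolyX0 ?mulr1 //.
  by apply/mnmP => j; rewrite mnmBE mnm0E subnn.
by rewrite mderivZ mderivX mnm1E ed !scale0r scaler0.
Qed.

Lemma mderiv_sqr n (p : {mpoly k[n]}) d : (p ^+ 2)^`M(d) = 0.
Proof.
by rewrite expr2 mderivM mulrC addrr_pchar2 // mpoly_char2.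
Qed.

Lemma pullback_kummer m (N : 'M[k]_(m, 4)) a b c (l := linf N) :
  pullback N (kummer_form a b c) =
  a *: (l 0 * l 1 + l 2 * l 3) ^+ 2 + b *: (l 0 * l 2 + l 1 * l 3) ^+ 2
  + c *: (l 0 * l 3 + l 1 * l 2) ^+ 2 + l 0 * l 1 * l 2 * l 3.
Proof.
have E i : 'X_i \mPo [tuple \sum_(u < m) N u j *: 'X_u | j < 4] = l i.
  by rewrite comp_mpolyXU -tnth_nth tnth_mktuple.
rewrite !(sqrrD_char2 (mpoly_char2 m)) !exprMn /pullback /kummer_form.
by rewrite !(comp_mpolyD, comp_mpolyZ, rmorphM, rmorphXn) /= !E.
Qed.

Lemma evalv_kummer (a b c : k) (v : 'rV[k]_4) (x := v 0) :
  evalv (kummer_form a b c) v =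
  a * (x 0 * x 1 + x 2 * x 3) ^+ 2 + b * (x 0 * x 2 + x 1 * x 3) ^+ 2
  + c * (x 0 * x 3 + x 1 * x 2) ^+ 2 + x 0 * x 1 * x 2 * x 3.
Proof.
rewrite !(sqrrD_char2 k2) !exprMn /evalv /kummer_form.
by rewrite !meval_simpl.
Qed.

(* The derivative of x y z w at p in the direction r. *)
Definition polar4 (p r : 'rV[k]_4) : k :=
  r 0 0 * p 0 1 * p 0 2 * p 0 3 + p 0 0 * r 0 1 * p 0 2 * p 0 3
  + p 0 0 * p 0 1 * r 0 2 * p 0 3 + p 0 0 * p 0 1 * p 0 2 * r 0 3.

(* In characteristic 2 only the term x y z w contributes to the derivatives. *)
Lemma polar4_eq0 m (N : 'M[k]_(m, 4)) a b c :
  (forall d, (pullback N (kummer_form a b c))^`M(d) = 0) ->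
  forall p r : 'rV[k]_m, polar4 (p *m N) (r *m N) = 0.
Proof.
move=> D0 p r.
have E d : polar4 (p *m N) (row d N) = 0.
  have := congr1 (fun f => evalv f p) (D0 d).
  rewrite pullback_kummer !mderivD !mderivZ !mderiv_sqr !scaler0 !add0r.
  rewrite !mderivM !mderiv_linf /evalv !meval_simpl.
  rewrite -!/(evalv _ p) !evalv_linf => E; rewrite -[RHS]E /polar4 !mxE.
  ring.
(* The gradient of x y z w at p *m N. The polar is linear in its second argument, so vanishing on
   the rows of N extends to their span. *)
pose q := row4 ((p *m N) 0 1 * (p *m N) 0 2 * (p *m N) 0 3)
  ((p *m N) 0 0 * (p *m N) 0 2 * (p *m N) 0 3)
  ((p *m N) 0 0 * (p *m N) 0 1 * (p *m N) 0 3)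
  ((p *m N) 0 0 * (p *m N) 0 1 * (p *m N) 0 2).
have qE s : polar4 (p *m N) s = (s *m q^T) 0 0.
  by rewrite mxE sum4E /polar4 ![q^T _ _]mxE !row4E; ring.
have Nq : N *m q^T = 0.
  by apply/row_matrixP => d; apply/rowP => j; rewrite row_mul ord1 -qE E !mxE.
by rewrite qE -mulmxA Nq mulmx0 mxE.
Qed.

End Pullback.

(** * The components of Bit(X) *)

Section Components.
Context {k : fieldType}.

(* In the coordinates v *m g, the lines meeting both x = y = 0 and z = w = 0. *)
Definition Wlines (g : 'M[k]_4) : lineset := fun L =>
  [/\ is_line L, minor2 (coordL g L) 0 1 = 0 & minor2 (coordL g L) 2 3 = 0].

(* In the coordinates v *m g, the lines contained in x = 0. *)
Definition Blines (g : 'M[k]_4) : lineset := fun L =>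
  is_line L /\ [/\ minor2 (coordL g L) 0 1 = 0, minor2 (coordL g L) 0 2 = 0
                 & minor2 (coordL g L) 0 3 = 0].

(** As [lift 0 i] is i + 1, the swaps of column 1 with 1, 2, 3 turn the pairing 01|23 into 01|23,
    02|13, 03|12. *)
Definition Wframe (g : 'M[k]_4) (i : 'I_3) := xcol 1 (lift 0 i) g.
Definition Bframe (g : 'M[k]_4) (j : 'I_4) := xcol 0 j g.

Definition bitcomp (g : 'M[k]_4) (u : 'I_3 + 'I_4) : lineset :=
  match u with
  | inl i => Wlines (Wframe g i)
  | inr j => Blines (Bframe g j)
  end.

Lemma forall3P (P : 'I_3 -> Prop) : P 0 -> P 1 -> P 2 -> forall i, P i.
Proof.
move=> P0 P1 P2 [[|[|[|i]]] Hi] //.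
- by rewrite (_ : Ordinal Hi = 0) //; apply: val_inj.
- by rewrite (_ : Ordinal Hi = 1) //; apply: val_inj.
- by rewrite (_ : Ordinal Hi = 2) //; apply: val_inj.
Qed.

Lemma minor2_xcol a b (g : 'M[k]_4) L i j :
  minor2 (coordL (xcol a b g) L) i j =
  minor2 (coordL g L) (tperm a b i) (tperm a b j).
Proof.
have E u v : coordL (xcol a b g) L u v = coordL g L u (tperm a b v).
  by rewrite !mxE; apply: eq_bigr => l _; rewrite !mxE.
by rewrite /minor2 !E.
Qed.

Lemma lift03E : (lift (0 : 'I_4) (0 : 'I_3) = 1) *
  (lift (0 : 'I_4) (1 : 'I_3) = 2) * (lift (0 : 'I_4) (2 : 'I_3) = 3).
Proof. by do ?split; apply: val_inj. Qed.

Lemma Bframe_unit (g : 'M[k]_4) j : g \in unitmx -> Bframe g j \in unitmx.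
Proof.
by move=> gu; rewrite /Bframe xcolE unitmx_mul gu unitmx_perm.
Qed.

Lemma Wframe_unit (g : 'M[k]_4) i : g \in unitmx -> Wframe g i \in unitmx.
Proof.
by move=> gu; rewrite /Wframe xcolE unitmx_mul gu unitmx_perm.
Qed.

Lemma bitcomp_inlP (g : 'M[k]_4) L (p := minor2 (coordL g L)) :
  [/\ bitcomp g (inl 0) L <-> [/\ is_line L, p 0 1 = 0 & p 2 3 = 0],
      bitcomp g (inl 1) L <-> [/\ is_line L, p 0 2 = 0 & p 1 3 = 0]
    & bitcomp g (inl 2) L <-> [/\ is_line L, p 0 3 = 0 & p 1 2 = 0]].
Proof.
rewrite /p /= /Wlines /Wframe !minor2_xcol !lift03E !permE /=.
by split=> //; split=> -[dL p1 p2]; split=> //; rewrite minor2C p2 oppr0.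
Qed.

Lemma bitcomp_inrP (g : 'M[k]_4) L j :
  bitcomp g (inr j) L <-> is_line L /\ forall i, minor2 (coordL g L) j i = 0.
Proof.
rewrite /= /Blines /Bframe !minor2_xcol tpermL; split=> -[dL].
  move=> [p1 p2 p3]; split=> // i.
  rewrite -(tpermK 0 j i); move: (tperm 0 j i); apply: forall4P => //.
  by rewrite tpermL minor2xx.
by move=> pj; split=> //; split; exact: pj.
Qed.

Lemma bitcomp_is_line g u L : bitcomp g u L -> is_line L.
Proof. by case: u => [i|j] /= []. Qed.

(** Viewed as edges of the complete graph on four vertices, the vanishing p_ij meet every vertex. A
    minimal edge cover of this graph is one of 3 perfect matchings or one of 4 stars, which are the
    seven cases. *)
Lemma bitcomp_cover (g : 'M[k]_4) L (p := minor2 (coordL g L)) : is_line L ->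
  p 0 1 * p 0 2 * p 0 3 = 0 -> p 0 1 * p 1 2 * p 1 3 = 0 ->
  p 0 2 * p 1 2 * p 2 3 = 0 -> p 0 3 * p 1 3 * p 2 3 = 0 ->
  exists u, bitcomp g u L.
Proof.
move=> dL /eqP p0 /eqP p1 /eqP p2 /eqP p3.
have star j : (forall i, i != j -> p j i == 0) -> bitcomp g (inr j) L.
  move=> pj; apply/bitcomp_inrP; split=> // i.
  by have [->|/pj/eqP//] := eqVneq i j; rewrite minor2xx.
have sym i j : (p i j == 0) = (p j i == 0) by rewrite /p minor2C oppr_eq0.
have [W0 W1 W2] := bitcomp_inlP g L; rewrite -/p in W0 W1 W2.
have : [|| (p 0 1 == 0) && (p 2 3 == 0), (p 0 2 == 0) && (p 1 3 == 0),
    (p 0 3 == 0) && (p 1 2 == 0),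
    [&& p 0 1 == 0, p 0 2 == 0 & p 0 3 == 0],
    [&& p 0 1 == 0, p 1 2 == 0 & p 1 3 == 0],
    [&& p 0 2 == 0, p 1 2 == 0 & p 2 3 == 0]
  | [&& p 0 3 == 0, p 1 3 == 0 & p 2 3 == 0]].
  move: p0 p1 p2 p3; rewrite !mulf_eq0.
  by case: (p 0 1 == 0); case: (p 0 2 == 0); case: (p 0 3 == 0);
    case: (p 1 2 == 0); case: (p 1 3 == 0); case: (p 2 3 == 0).
case/or4P => [/andP[/eqP a /eqP b]|/andP[/eqP a /eqP b]|/andP[/eqP a /eqP b]|].
- by exists (inl 0); apply/W0.
- by exists (inl 1); apply/W1.
- by exists (inl 2); apply/W2.
case/or4P => /and3P[a b c]; [exists (inr 0) | exists (inr 1) | exists (inr 2)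
  | exists (inr 3)]; apply: star; apply: forall4P => //; by rewrite sym.
Qed.

(** By the identity N_d0 p_ij = N_di p_0j - N_dj p_0i, a nonzero entry in column 0 would make all
    minors vanish. So the star condition really puts L in the plane x = 0. *)
Lemma Blines_coord0 (g : 'M[k]_4) L d :
  g \in unitmx -> Blines g L -> coordL g L d 0 = 0.
Proof.
move=> gu [dL [p1 p2 p3]]; apply/eqP; have := coordL_neq0 gu dL.
apply: contraNT => d0; set N := coordL g L in p1 p2 p3 d0 *.
have p0 : forall i, minor2 N 0 i = 0 by apply: forall4P => //; exact: minor2xx.
have m0 i j : minor2 N i j = 0.
  apply: (mulfI d0); rewrite mulr0.
  transitivity (N d i * minor2 N 0 j - N d j * minor2 N 0 i).
    by move: d {d0}; apply: forall2P; rewrite /minor2; ring.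
  by rewrite !p0 !mulr0 subrr.
by rewrite -row6_0 /minor6 !m0.
Qed.

End Components.

(** * Bit(X) as the union of the seven components *)

Section BitangentLines.
Context {k : closedFieldType} (k2 : 2%N \in [pchar k]).

(** The square of the product of the two point forms already has degree 4, so the cofactor is
    constant and the restriction of F is a constant times a square. *)
Lemma bitangent_deriv (F : {mpoly k[4]}) (M : 'M[k]_(2, 4)) a b :
  F \is 4.-homog -> a != 0 -> b != 0 -> bitangent_at F M a b ->
  forall d, (pullback M F)^`M(d) = 0.
Proof.
move=> hF a0 b0 [h fE] d.
have [->|f0] := eqVneq (pullback M F) 0; first exact: raddf0.
have hf := dhomog_pullback M hF.
pose q := point_form a * point_form b.
have hq2 : q ^+ 2 \is 4.-homog.
  exact: (dhomogMn 2 (dhomogM (point_form_homog a) (point_form_homog b))).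
have q20 : q ^+ 2 != 0 by rewrite expf_neq0 // mulf_neq0 // point_form_neq0.
rewrite -exprMn -/q in fE.
have h0 : h != 0 by apply: contraNneq f0 => h0; rewrite fE h0 mulr0.
have := msizeM q20 h0; rewrite -fE (msize_homog hf f0) (msize_homog hq2 q20).
move=> /= [/esym/eqP]; rewrite -[X in _ == X]addn0 eqn_add2l.
case/msize_poly1P => c _ hE; rewrite fE hE mulrC mul_mpolyC mderivZ mderiv_sqr //.
by rewrite scaler0.
Qed.

Lemma Bit_bitcomp_sub (g : 'M[k]_4) a b c L :
  Bit (pullback g (kummer_form a b c)) L -> exists u, bitcomp g u L.
Proof.
move=> [dL bit].
have D0 d : (pullback (coordL g L) (kummer_form a b c))^`M(d) = 0.
  rewrite /coordL -pullbackM; case: bit => [->|[u [v [u0 v0 bt]]]].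
    exact: raddf0.
  apply: (bitangent_deriv _ u0 v0 bt); apply: dhomog_pullback.
  exact: kummer_form_homog.
have [N NE] : exists N, N = coordL g L by exists (coordL g L).
rewrite -NE in D0.
(* The parameter (N_1i, -N_0i) is the zero of the i-th coordinate form on L; the point there has
   coordinates p_ji. As p_ii = 0, only the term differentiating the i-th factor remains. *)
have polN i r : polar4 (row4 (minor2 N 0 i) (minor2 N 1 i) (minor2 N 2 i)
    (minor2 N 3 i)) (r *m N) = 0.
  rewrite -[RHS](polar4_eq0 k2 D0 (N 1 i *: delta_mx 0 0 - N 0 i *: delta_mx 0 1)
    r).
  congr polar4; rewrite mulmxBl -!scalemxAl -!rowE; apply/rowP.
  by apply: forall4P; rewrite row4E !mxE /minor2; ring.
(* P will be the product of the three p_ji with j different from i. Either it is zero, or the i-th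
   coordinate form vanishes on L and then every p_ji is zero. *)
have T i P : (forall r : 'rV_2, (r *m N) 0 i * P = 0) ->
    forall j, minor2 N j i = 0 \/ P = 0.
  move=> NP j; have E d : N d i * P = 0.
    by have := NP (delta_mx 0 d); rewrite -rowE mxE.
  have /eqP : minor2 N j i * P = 0.
    transitivity (N 0 j * (N 1 i * P) - N 1 j * (N 0 i * P)).
      by rewrite /minor2; ring.
    by rewrite !E !mulr0 subrr.
  by rewrite mulf_eq0 => /orP[]/eqP; [left | right].
apply: (@bitcomp_cover _ g L dL); rewrite -NE.
- rewrite !(minor2C _ 0).
  have [r||] := T 0 (minor2 N 1 0 * minor2 N 2 0 * minor2 N 3 0) _ 1.
  + by rewrite -[RHS](polN 0 r) /polar4 !row4E minor2xx; ring.
  + by move=> ->; ring.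
  + by rewrite !mulrNN mulrN => ->; rewrite oppr0.
- rewrite !(minor2C _ 1 2) !(minor2C _ 1 3).
  have [r||] := T 1 (minor2 N 0 1 * minor2 N 2 1 * minor2 N 3 1) _ 0.
  + by rewrite -[RHS](polN 1 r) /polar4 !row4E minor2xx; ring.
  + by move=> ->; ring.
  + by move=> E; rewrite -[RHS]E; ring.
- rewrite !(minor2C _ 2 3).
  have [r||] := T 2 (minor2 N 0 2 * minor2 N 1 2 * minor2 N 3 2) _ 0.
  + by rewrite -[RHS](polN 2 r) /polar4 !row4E minor2xx; ring.
  + by move=> ->; ring.
  + by move=> E; rewrite -[RHS]oppr0 -E; ring.
- have [r||] := T 3 (minor2 N 0 3 * minor2 N 1 3 * minor2 N 2 3) _ 0.
  + by rewrite -[RHS](polN 3 r) /polar4 !row4E minor2xx; ring.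
  + by move=> ->; ring.
  + by [].
Qed.

Lemma linf_tperm (s t i : 'I_4) : linf (tperm_mx s t : 'M[k]_4) i = 'X_(tperm s t i).
Proof.
rewrite /linf (bigD1 (tperm s t i)) //= big1 => [|j ji].
  by rewrite !mxE tpermK eqxx scale1r addr0.
rewrite !mxE (_ : (_ == i) = false) ?scale0r //.
by apply/negbTE; apply: contraNneq ji => <-; rewrite tpermK.
Qed.

Lemma pullback_xcol (s t : 'I_4) (g : 'M[k]_4) (a b c : k) :
  pullback (xcol s t g) (kummer_form a b c) =
  pullback g (pullback (tperm_mx s t) (kummer_form a b c)).
Proof. by rewrite pullbackM xcolE. Qed.

(** The identity is disguised as a transposition so that [pullback_kummer] and [linf_tperm] expand
    both sides of a change of frame alike. *)
Lemma kummer_linf1 (a b c : k) : kummer_form a b c =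
  pullback (tperm_mx 0 0) (kummer_form a b c).
Proof. by rewrite /tperm_mx tperm1 perm_mx1 pullback1. Qed.

(** A transposition of the coordinates permutes their three pairings, hence only the coefficients a,
    b, c. This reduces the three congruences to a single one. *)
Lemma Wframe_kummer (g : 'M[k]_4) (a b c : k) i :
  a != 0 -> b != 0 -> c != 0 -> exists a' b' c',
  [/\ a' != 0, b' != 0, c' != 0 & pullback g (kummer_form a b c) =
    pullback (Wframe g i) (kummer_form a' b' c')].
Proof.
move=> a0 b0 c0; move: i; apply: forall3P; rewrite /Wframe lift03E;
  [exists a, b, c | exists b, a, c | exists c, b, a]; split=> //;
  rewrite pullback_xcol; congr pullback; symmetry;
  by rewrite [RHS]kummer_linf1 !(pullback_kummer k2) !linf_tperm !permE /=
    -!mul_mpolyC; ring.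
Qed.

Lemma Bframe_kummer (g : 'M[k]_4) (a b c : k) j :
  a != 0 -> b != 0 -> c != 0 -> exists a' b' c',
  [/\ a' != 0, b' != 0, c' != 0 & pullback g (kummer_form a b c) =
    pullback (Bframe g j) (kummer_form a' b' c')].
Proof.
move=> a0 b0 c0; move: j; apply: forall4P; rewrite /Bframe;
  [exists a, b, c | exists a, c, b | exists c, b, a | exists b, a, c];
  split=> //; rewrite pullback_xcol; congr pullback; symmetry;
  by rewrite [RHS]kummer_linf1 !(pullback_kummer k2) !linf_tperm !permE /=
    -!mul_mpolyC; ring.
Qed.

Definition quadform (q : {mpoly k[2]}) := exists A B C,
  q = A *: 'X_0 ^+ 2 + B *: ('X_0 * 'X_1) + C *: 'X_1 ^+ 2.

Lemma quadformD p q : quadform p -> quadform q -> quadform (p + q).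
Proof.
move=> [A [B [C ->]]] [A' [B' [C' ->]]]; exists (A + A'), (B + B'), (C + C').
by rewrite -!mul_mpolyC !mpolyCD; ring.
Qed.

Lemma quadformZ r p : quadform p -> quadform (r *: p).
Proof.
move=> [A [B [C ->]]]; exists (r * A), (r * B), (r * C).
by rewrite -!mul_mpolyC !mpolyCM; ring.
Qed.

Definition linform (l : {mpoly k[2]}) := exists p q, l = p *: 'X_0 + q *: 'X_1.

Lemma quadformM l m : linform l -> linform m -> quadform (l * m).
Proof.
move=> [p [q ->]] [r [s ->]]; exists (p * r), (p * s + q * r), (q * s).
by rewrite -!mul_mpolyC mpolyCD !mpolyCM; ring.
Qed.

Lemma linform_linf (N : 'M[k]_(2, 4)) i : linform (linf N i).
Proof. by exists (N 0 i), (N 1 i); rewrite /linf sum2E. Qed.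

(** A nonzero entry of column i serves as denominator; if column i is zero, the common form is the
    j-th one and r = 0. *)
Lemma linf_proportional (N : 'M[k]_(2, 4)) i j : minor2 N i j = 0 ->
  exists m r s, [/\ linform m, linf N i = r *: m & linf N j = s *: m].
Proof.
rewrite /minor2 => /eqP; rewrite subr_eq0 => /eqP mE.
have [i0|i0] := eqVneq (N 0 i) 0; last first.
  exists (linf N i), 1, (N 0 j / N 0 i); split; rewrite ?scale1r //.
    exact: linform_linf.
  rewrite /linf !sum2E scalerDr !scalerA divfK //; congr (_ + _ *: _).
  by apply: (mulfI i0); rewrite mE; field.
have [i1|i1] := eqVneq (N 1 i) 0; last first.
  exists (linf N i), 1, (N 1 j / N 1 i); split; rewrite ?scale1r //.
    exact: linform_linf.
  rewrite /linf !sum2E scalerDr !scalerA divfK //; congr (_ *: _ + _).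
  by apply: (mulIf i1); rewrite -mE; field.
exists (linf N j), 0, 1; split; rewrite ?scale1r ?scale0r //.
  exact: linform_linf.
by rewrite /linf sum2E i0 i1 !scale0r addr0.
Qed.

Lemma bitangent_square (F : {mpoly k[4]}) L q : is_line L ->
  quadform q -> pullback (basis_mx 2 L) F = q ^+ 2 -> Bit F L.
Proof.
move=> dL [A [B [C qE]]] FE; split=> //.
have [p [p' [r [r' [AE BE CE]]]]] := quadratic_factor A B C.
(* The zero of s X_0 + t X_1, with the sign convention of [point_form]. *)
pose pt (s t : k) : 'rV[k]_2 := \row_i (if i == 0 then - t else s).
have ptE s t : point_form (pt s t) = s *: 'X_0 + t *: 'X_1.
  by rewrite /point_form !mxE /= scaleNr opprK.
have qptE : q = point_form (pt p p') * point_form (pt r r').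
  rewrite qE !ptE AE BE CE -!mul_mpolyC !mpolyCD !mpolyCM; ring.
have [q0|q0] := eqVneq q 0; first by left; rewrite FE q0 expr0n.
have pt0 s t : pt s t = 0 -> point_form (pt s t) = 0.
  by move=> ->; rewrite /point_form !mxE !scale0r subrr.
right; exists (pt p p'), (pt r r'); split.
- by apply: contraNneq q0 => E; rewrite qptE (pt0 _ _ E) mul0r.
- by apply: contraNneq q0 => E; rewrite qptE (pt0 _ _ E) mulr0.
- by exists 1; rewrite FE qptE exprMn mulr1.
Qed.

(** With square roots of a, b, c, the other three terms are squares of quadratic forms, and in
    characteristic 2 a sum of squares is a square. *)
Lemma Bit_of_product (g : 'M[k]_4) a b c L (l := linf (coordL g L)) q :
  is_line L -> quadform q -> l 0 * l 1 * l 2 * l 3 = q ^+ 2 ->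
  Bit (pullback g (kummer_form a b c)) L.
Proof.
move=> dL qq qE.
have [ra <-] := sqrt_exists a; have [rb <-] := sqrt_exists b.
have [rc <-] := sqrt_exists c.
apply: (@bitangent_square _ _ (ra *: (l 0 * l 1 + l 2 * l 3)
  + rb *: (l 0 * l 2 + l 1 * l 3) + rc *: (l 0 * l 3 + l 1 * l 2) + q)) => //.
  have lin i : linform (l i) by exact: linform_linf.
  by do !(apply: quadformD || apply: quadformZ || exact: quadformM || done).
rewrite pullbackM (pullback_kummer k2) -/(coordL g L) -/l qE.
by rewrite !(sqrrD_char2 (mpoly_char2 k2 2)) !exprZn
  !(sqrrD_char2 (mpoly_char2 k2 2)).
Qed.

Lemma Wlines_Bit (g : 'M[k]_4) a b c L :
  Wlines g L -> Bit (pullback g (kummer_form a b c)) L.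
Proof.
move=> [dL /linf_proportional[m [r [s [lm E0 E1]]]]].
move=> /linf_proportional[m' [r' [s' [lm' E2 E3]]]].
have [t tE] := sqrt_exists (r * s * r' * s').
apply: (@Bit_of_product _ _ _ _ _ (t *: (m * m'))) => //.
  by apply: quadformZ; exact: quadformM.
rewrite E0 E1 E2 E3 exprZn tE -!mul_mpolyC !mpolyCM; ring.
Qed.

Lemma Blines_Bit (g : 'M[k]_4) a b c L : g \in unitmx ->
  Blines g L -> Bit (pullback g (kummer_form a b c)) L.
Proof.
move=> gu bL; have [dL _] := bL.
apply: (@Bit_of_product _ _ _ _ _ 0) => //.
  by exists 0, 0, 0; rewrite !scale0r !addr0.
rewrite /linf sum2E !(Blines_coord0 _ gu bL) !scale0r addr0 !mul0r.
by rewrite expr0n.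
Qed.

Lemma Bit_bitcomp (g : 'M[k]_4) (a b c : k) L :
  g \in unitmx -> a != 0 -> b != 0 -> c != 0 ->
  Bit (pullback g (kummer_form a b c)) L <-> exists u, bitcomp g u L.
Proof.
move=> gu a0 b0 c0; split=> [/Bit_bitcomp_sub//|[[i|j] cL]].
  have [a' [b' [c' [_ _ _ ->]]]] := Wframe_kummer g i a0 b0 c0.
  exact: Wlines_Bit.
have [a' [b' [c' [_ _ _ ->]]]] := Bframe_kummer g j a0 b0 c0.
by apply: Blines_Bit; first exact: Bframe_unit.
Qed.

End BitangentLines.

(** * Closed and irreducible sets of lines *)

Section Closed.
Context {k : fieldType}.

Lemma same_lines_closed (A B : @lineset k) :
  same_lines A B -> closed_lines A -> closed_lines B.
Proof.
move=> AB [S [hS AE]]; exists S; split=> // L.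
by rewrite -(AE L); split=> /AB.
Qed.

Lemma closed_inter (A B : @lineset k) : closed_lines A -> closed_lines B ->
  closed_lines (fun L => A L /\ B L).
Proof.
move=> [S [hS AE]] [T [hT BE]]; exists (fun f => S f \/ T f); split.
  by move=> f [/hS|/hT].
move=> L; rewrite AE BE; split=> [[[dL SL] [_ TL]]|[dL ST]].
  by split=> // f [/SL|/TL].
by split; split=> // f ?; apply: ST; [left | right].
Qed.

Lemma closed_union (A B : @lineset k) : closed_lines A -> closed_lines B ->
  closed_lines (fun L => A L \/ B L).
Proof.
move=> [S [hS AE]] [T [hT BE]].
exists (fun h => exists f g, [/\ S f, T g & h = f * g]); split.
  move=> h [f [g [/hS[d hf] /hT[e hg] ->]]]; exists (d + e)%N; exact: dhomogM.
move=> L; split.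
  move=> [/AE[dL SL]|/BE[dL TL]]; split=> // h [f [g [Sf Tg ->]]];
    rewrite evalvM.
    by rewrite SL // mul0r.
  by rewrite (TL g) // mulr0.
move=> [dL fg]; case: (classic (A L)) => [|nA]; [by left | right].
apply/BE; split=> // g Tg; apply: NNPP => gL; case: nA; apply/AE; split=> // f Sf.
have := fg _ (ex_intro _ f (ex_intro _ g (And3 Sf Tg erefl))).
rewrite evalvM => /eqP; rewrite mulf_eq0.
by case/orP => /eqP.
Qed.

Lemma closed_empty : closed_lines (fun _ : {vspace 'rV[k]_4} => False).
Proof.
exists (fun f => f = 1); split=> [f ->|L]; first by exists 0%N; exact: dhomog1.
split=> // -[_ /(_ 1 erefl)/eqP].
by rewrite /evalv meval1 oner_eq0.
Qed.

Lemma closed_linear (g : 'M[k]_4) (h : 'rV[k]_6) : closed_lines (fun L =>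
  is_line L /\ minor6 (coordL g L) *m h^T = 0).
Proof.
pose w := wedge g *m h^T; pose f : {mpoly k[6]} := \sum_j w j 0 *: 'X_j.
exists (fun f' => f' = f); split=> [_ ->|L].
  exists 1%N; apply: rpred_sum => j _; apply: rpredZ.
  by rewrite dhomogX /= mdeg1.
have fE : evalv f (plucker L) = (minor6 (coordL g L) *m h^T) 0 0.
  rewrite minor6_coordL -mulmxA mxE /evalv raddf_sum /=.
  by apply: eq_bigr => j _; rewrite !meval_simpl mulrC.
split=> -[dL E]; split=> //; first by move=> _ ->; rewrite fE E mxE.
by apply/matrixP => i j; rewrite !ord1 [RHS]mxE -fE E.
Qed.

Lemma row6_dotP (p : 'rV[k]_6) (a b c d e f a' b' c' d' e' f' : k) :
  p = row6 a b c d e f ->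
  p *m (row6 a' b' c' d' e' f')^T = 0 <->
  a * a' + b * b' + c * c' + d * d' + e * e' + f * f' = 0.
Proof.
move=> ->; rewrite row6_dot; split=> [|->]; last exact: raddf0.
by move=> /matrixP/(_ 0 0); rewrite !mxE eqxx mulr1n.
Qed.

Lemma closed_Wlines (g : 'M[k]_4) : closed_lines (Wlines g).
Proof.
apply: same_lines_closed (closed_inter
  (closed_linear g (row6 1 0 0 0 0 0)) (closed_linear g (row6 0 0 0 0 0 1))) => L.
rewrite /Wlines /Blines !(row6_dotP _ _ _ _ _ _ (erefl (minor6 _))).
rewrite !mulr0 !mulr1 ?add0r ?addr0.
by split=> [[[dL ->] [_ ->]]|[dL -> ->]].
Qed.

Lemma closed_Blines (g : 'M[k]_4) : closed_lines (Blines g).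
Proof.
apply: same_lines_closed (closed_inter (closed_inter
  (closed_linear g (row6 1 0 0 0 0 0)) (closed_linear g (row6 0 1 0 0 0 0)))
  (closed_linear g (row6 0 0 1 0 0 0))) => L.
rewrite /Wlines /Blines !(row6_dotP _ _ _ _ _ _ (erefl (minor6 _))).
rewrite !mulr0 !mulr1 ?add0r ?addr0.
by split=> [[[[dL ->] [_ ->]] [_ ->]]|[dL [-> -> ->]]].
Qed.

Lemma closed_comp (g : 'M[k]_4) u : closed_lines (bitcomp g u).
Proof.
by case: u => ?; [exact: closed_Wlines | exact: closed_Blines].
Qed.

Lemma closed_cover (I : eqType) (Z : I -> @lineset k) (s : seq I) :
  (forall u, closed_lines (Z u)) ->
  closed_lines (fun L => exists2 u, u \in s & Z u L).
Proof.
move=> cZ; elim: s => [|u s IH].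
  by apply: same_lines_closed closed_empty => L; split=> // -[].
apply: same_lines_closed (closed_union (cZ u) IH) => L; split.
  move=> [ZL|[v vs ZL]]; first by exists u; rewrite // inE eqxx.
  by exists v; rewrite // inE vs orbT.
by move=> [v]; rewrite inE => /orP[/eqP->|vs ZL]; [left | right; exists v].
Qed.

Lemma irreducible_cover (I : eqType) (Z : I -> @lineset k) (s : seq I) A :
  (forall u, closed_lines (Z u)) -> irreducible_lines A ->
  (forall L, A L -> exists2 u, u \in s & Z u L) ->
  exists2 u, u \in s & forall L, A L -> Z u L.
Proof.
move=> cZ [[L0 AL0] irA]; elim: s => [|u s IH] As; first by case: (As _ AL0).
case: (irA (Z u) _ (cZ u) (closed_cover s cZ)) => [L /As[v]|Au|/IH[v vs Av]].
- by rewrite inE => /orP[/eqP->|vs ZL]; [left | right; exists v].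
- by exists u; rewrite // inE eqxx.
- by exists v; rewrite // inE vs orbT.
Qed.

(** An irreducible subset of a finite union of closed sets lies in one of them. So each component is
    some [Z u], and each [Z u] is maximal because no inclusion holds between distinct members. *)
Lemma irreducible_component_cover (I : finType) (Z : I -> @lineset k) W :
  (forall u, closed_lines (Z u)) -> (forall u, irreducible_lines (Z u)) ->
  (forall L, W L <-> exists u, Z u L) ->
  (forall u v, (forall L, Z u L -> Z v L) -> u = v) ->
  forall A, irreducible_component W A <-> exists u, same_lines A (Z u).
Proof.
move=> cZ irZ WE Zinj A.
have sub B : irreducible_lines B -> (forall L, B L -> W L) ->
    exists u, forall L, B L -> Z u L.
  move=> irB BW; have [|u _ Bu] := irreducible_cover (s := enum I) cZ irB.
    by move=> L /BW/WE[u ZL]; exists u; rewrite // mem_enum.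
  by exists u.
have ZW u L : Z u L -> W L by move=> ZL; apply/WE; exists u.
split=> [[cA irA AW maxA]|[u Au]].
  have [u Au] := sub A irA AW; exists u => L; split; first exact: Au.
  by apply: (maxA (Z u)) => //; exact: ZW.
split.
- by apply: same_lines_closed (cZ u) => L; split=> /Au.
- have [[L0 ZL0] irZu] := irZ u; split; first by exists L0; apply/Au.
  move=> B C cB cC ABC.
  case: (irZu B C cB cC) => [L /Au/ABC//|uB|uC]; [left | right] => L /Au;
    [exact: uB | exact: uC].
- by move=> L /Au; exact: ZW.
- move=> B cB irB BW AB L BL; have [v Bv] := sub B irB BW.
  suff uv : u = v by apply/Au; rewrite uv; exact: Bv.
  by apply: Zinj => L' ZL; apply/Bv/AB/Au.
Qed.

End Closed.

Section Irreducible.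
Context {k : closedFieldType}.

Lemma polyfun_evalv_wedge n (g : 'M[k]_4) (psi : 'rV[k]_n -> 'rV[k]_6) f :
  (forall j, polyfun (fun t => psi t 0 j)) ->
  polyfun (fun t => evalv f (psi t *m wedge (invmx g))).
Proof.
move=> ppsi; apply: (@polyfun_comp _ _ _ (evalv f)); first by exists f.
by move=> i; apply: polyfun_mulmx => i' j; rewrite ord1.
Qed.

Lemma evalv_plucker_coordL (g : 'M[k]_4) f d L c p : g \in unitmx ->
  f \is d.-homog -> c != 0 -> p = c *: minor6 (coordL g L) ->
  (evalv f (p *m wedge (invmx g)) == 0) = (evalv f (plucker L) == 0).
Proof.
move=> gu hf c0 ->; rewrite -scalemxAl minor6_coordL -mulmxA wedgeK // mulmx1.
exact: evalv_homog_eq0 hf c0.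
Qed.

(* Two nonempty open subsets of the affine space of parameters meet. *)
Lemma irreducible_param n (g : 'M[k]_4) (psi : 'rV[k]_n -> 'rV[k]_6)
    (Z : @lineset k) :
  g \in unitmx -> (forall j, polyfun (fun t => psi t 0 j)) ->
  (forall L, Z L -> is_line L) ->
  (forall L, Z L -> exists t c, c != 0 /\ psi t = c *: minor6 (coordL g L)) ->
  (forall t, psi t != 0 ->
     exists L c, [/\ Z L, c != 0 & psi t = c *: minor6 (coordL g L)]) ->
  (exists L, Z L) -> irreducible_lines Z.
Proof.
move=> gu ppsi dZ Zpsi psiZ neZ; split=> // A B [S [hS AE]] [T [hT BE]] ZAB.
case: (classic (forall L, Z L -> A L)) => [|nA]; [by left | right=> L ZL].
apply/BE; split=> [|q Tq]; first exact: dZ.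
apply: NNPP => /eqP qL.
case: nA => M ZM; apply/AE; split=> [|p Sp]; first exact: dZ.
apply: NNPP => /eqP pM.
have [d hp] := hS _ Sp; have [e hq] := hT _ Tq.
have [t [c [c0 tE]]] := Zpsi _ ZM; have [t' [c' [c0' tE']]] := Zpsi _ ZL.
rewrite -(evalv_plucker_coordL gu hp c0 tE) in pM.
rewrite -(evalv_plucker_coordL gu hq c0' tE') in qL.
have pp := polyfun_evalv_wedge g p ppsi; have pq := polyfun_evalv_wedge g q ppsi.
(* A third open condition is needed besides p and q: only a parameter with nonzero [psi] yields a
   line of Z. *)
have /existsP[j tj] : [exists j, psi t 0 j != 0].
  apply: contraT; rewrite negb_exists => /forallP t0.
  have /eqP : minor6 (coordL g M) = 0.
    apply/rowP => j; have /eqP := negbNE (t0 j).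
    by rewrite tE !mxE => /eqP; rewrite mulf_eq0 (negPf c0) => /eqP.
  by rewrite (negPf (coordL_neq0 gu (dZ _ ZM))).
have [s [/= ps /eqP qs]] := polyfun_meet pp pq pM qL.
have pqs := mulf_neq0 ps (introN eqP qs).
have [s' []] := polyfun_meet (polyfunM pp pq) (ppsi j) pqs tj.
rewrite mulf_eq0 negb_or => /andP[ps' qs'] js'.
have [|N [c'' [ZN c0'' NE]]] := psiZ s'.
  by apply: contraNneq js' => ->; rewrite mxE.
rewrite (evalv_plucker_coordL gu hp c0'' NE) in ps'.
rewrite (evalv_plucker_coordL gu hq c0'' NE) in qs'.
case: (ZAB _ ZN) => [/AE[_ /(_ _ Sp)/eqP]|/BE[_ /(_ _ Tq)/eqP]].
  by rewrite (negPf ps').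
by rewrite (negPf qs').
Qed.

End Irreducible.

(** * Explicit lines in the components *)

Section Families.
Context {k : fieldType}.

Lemma row6_neq0 (a b c d e f : k) :
  (row6 a b c d e f != 0) =
  [|| a != 0, b != 0, c != 0, d != 0 | (e != 0) || (f != 0)].
Proof.
apply/idP/idP => [|ne].
  apply: contraNT; rewrite !negb_or !negbK.
  by case/and5P=> /eqP-> /eqP-> /eqP-> /eqP-> /andP[/eqP-> /eqP->];
    rewrite row6_0.
apply: contraTneq ne; rewrite -row6_0 => /row6_inj[[-> -> ->] [-> -> ->]].
by rewrite eqxx.
Qed.

Lemma line_of_coords (g : 'M[k]_4) (x y : 'rV[k]_4)
    (L := <<[:: x *m invmx g; y *m invmx g]>>%VS) :
  g \in unitmx -> minor6 (col_mx x y) != 0 -> is_line L /\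
  exists2 c, c != 0 & minor6 (col_mx x y) = c *: minor6 (coordL g L).
Proof.
move=> gu /free_minor6 fr.
have fr' : free [:: x *m invmx g; y *m invmx g].
  by apply: free_mulmx; rewrite ?unitmx_inv.
split; first exact: is_line_span.
have [c c0] := span_minor6_coordL g fr'; rewrite !mulmxKV // => E.
by exists c.
Qed.

Lemma singular2 (a b c d : k) : a * d - b * c = 0 ->
  exists x y, (x != 0) || (y != 0) /\ x * a + y * b = 0 /\ x * c + y * d = 0.
Proof.
move=> dt; have [ab|] := boolP ((b != 0) || (a != 0)).
  exists b, (- a); rewrite oppr_eq0; split=> //; split; first by ring.
  by rewrite -[RHS]oppr0 -dt; ring.
rewrite negb_or !negbK => /andP[/eqP-> /eqP->].
have [cd|] := boolP ((d != 0) || (c != 0)).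
  by exists d, (- c); rewrite oppr_eq0; split=> //; split; ring.
rewrite negb_or !negbK => /andP[/eqP-> /eqP->].
by exists 1, 0; rewrite oner_eq0 !mulr0 addr0.
Qed.

(** The Segre embedding of P^1 x P^1, onto the quadric p02 p13 = p03 p12 to which the Plücker
    relation reduces when p01 = p23 = 0. *)
Definition Wpsi (t : 'rV[k]_4) : 'rV[k]_6 :=
  row6 0 (t 0 0 * t 0 2) (t 0 0 * t 0 3) (t 0 1 * t 0 2) (t 0 1 * t 0 3) 0.

(* The line of Wlines g through the point with coordinates t = v *m g. *)
Definition Wline (g : 'M[k]_4) (t : 'rV[k]_4) : {vspace 'rV[k]_4} :=
  let u := row4 (t 0 0) (t 0 1) 0 0 *m invmx g in
  let v := row4 0 0 (t 0 2) (t 0 3) *m invmx g in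
  <<[:: u; v]>>%VS.

Lemma minor6_Wline (t : 'rV[k]_4) :
  minor6 (col_mx (row4 (t 0 0) (t 0 1) 0 0) (row4 0 0 (t 0 2) (t 0 3)))
  = Wpsi t.
Proof.
rewrite /minor6 /minor2 !col_mx2E !row4E /Wpsi.
by congr row6; ring.
Qed.

Lemma Wpsi_neq0 (t : 'rV[k]_4) : (Wpsi t != 0) =
  ((t 0 0 != 0) || (t 0 1 != 0)) && ((t 0 2 != 0) || (t 0 3 != 0)).
Proof.
rewrite row6_neq0 !mulf_eq0 eqxx /=.
by case: (t 0 0 == 0); case: (t 0 1 == 0); case: (t 0 2 == 0);
  case: (t 0 3 == 0).
Qed.

Lemma Wlines_Wline (g : 'M[k]_4) t : g \in unitmx -> Wpsi t != 0 ->
  Wlines g (Wline g t) /\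
  exists2 c, c != 0 & Wpsi t = c *: minor6 (coordL g (Wline g t)).
Proof.
rewrite -minor6_Wline => gu /(line_of_coords gu)[dL [c c0 E]].
split; last by exists c.
move: E; rewrite minor6_Wline row6Z => /row6_inj[[m01 _ _] [_ _ m23]].
by split=> //; apply: (mulfI c0); rewrite mulr0.
Qed.

Lemma WlinesP (g : 'M[k]_4) L : g \in unitmx ->
  Wlines g L <-> exists2 t, Wpsi t != 0 & L = Wline g t.
Proof.
move=> gu; split=> [[dL p01 p23]|[t t0 ->]]; last first.
  by have [] := Wlines_Wline gu t0.
(* If p_ij = 0, columns i and j of the basis are dependent, so some point of L has both coordinates
   zero: L meets that edge. *)
have kerL i j : minor2 (coordL g L) i j = 0 -> exists x : 'rV[k]_4,
    [/\ x != 0, x *m invmx g \in L, x 0 i = 0 & x 0 j = 0].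
  rewrite /minor2 [_ 0 j * _]mulrC => /singular2[a [b [ab [Ei Ej]]]].
  pose s : 'rV[k]_2 := a *: delta_mx 0 0 + b *: delta_mx 0 1.
  have sE l : (s *m coordL g L) 0 l = a * coordL g L 0 l + b * coordL g L 1 l.
    by rewrite mulmxDl -!scalemxAl -!rowE !mxE.
  exists (s *m coordL g L); split; rewrite ?sE //.
    apply: contraL ab => /eqP sN.
    have : s *m basis_mx 2 L = 0.
      by rewrite -[LHS](mulmxK gu) -(mulmxA s) -/(coordL g L) sN mul0mx.
    move=> /(basis_mx_free dL) s0.
    have := congr1 (fun v : 'rV_2 => v 0 0) s0.
    have := congr1 (fun v : 'rV_2 => v 0 1) s0.
    rewrite !mxE /= !mulr0 !mulr1 ?addr0 ?add0r => -> ->.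
    by rewrite eqxx.
  by apply/(memv_basis_mx _ dL); exists s; rewrite /coordL mulmxA mulmxK.
have [x [x0 xL x0E x1E]] := kerL _ _ p01.
have [y [y0 yL y2E y3E]] := kerL _ _ p23.
pose t := row4 (y 0 0) (y 0 1) (x 0 2) (x 0 3).
have ty : row4 (t 0 0) (t 0 1) 0 0 = y.
  by rewrite !row4E [RHS]row4_eta y2E y3E.
have tx : row4 0 0 (t 0 2) (t 0 3) = x.
  by rewrite !row4E [RHS]row4_eta x0E x1E.
have t0 : Wpsi t != 0.
  rewrite Wpsi_neq0; apply/andP; split.
    apply: contraNT y0; rewrite negb_or !negbK -ty => /andP[/eqP-> /eqP->].
    by apply/eqP/rowP; apply: forall4P; rewrite row4E mxE.
  apply: contraNT x0; rewrite negb_or !negbK -tx => /andP[/eqP-> /eqP->].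
  by apply/eqP/rowP; apply: forall4P; rewrite row4E mxE.
exists t => //; rewrite /Wline ty tx; apply: line_span => //.
apply: free_mulmx; rewrite ?unitmx_inv //; apply/free_minor6.
by rewrite -tx -ty minor6_Wline.
Qed.

(** A line through p meeting both edges contains the projections of p to the two edges. The
    condition on [Wpsi] says that p lies on neither edge, so these projections are two points. *)
Lemma Wline_through (g : 'M[k]_4) (p : 'rV[k]_4) L : g \in unitmx ->
  Wpsi (p *m g) != 0 -> Wlines g L /\ p \in L <-> L = Wline g (p *m g).
Proof.
move=> gu; have : p = (p *m g) *m invmx g by rewrite mulmxK.
move: (p *m g) => x pE x0.
have frx : free [:: row4 (x 0 0) (x 0 1) 0 0 *m invmx g;
                    row4 0 0 (x 0 2) (x 0 3) *m invmx g].
  apply: free_mulmx; rewrite ?unitmx_inv //; apply/free_minor6.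
  by rewrite minor6_Wline.
have xE : x = row4 (x 0 0) (x 0 1) 0 0 + row4 0 0 (x 0 2) (x 0 3).
  by apply/rowP; apply: forall4P; rewrite [RHS]mxE !row4E ?addr0 ?add0r.
split=> [[/(WlinesP _ gu)[t t0 ->] pL]|->].
  have [[dL _ _] _] := Wlines_Wline gu t0.
  have /span2P[a [b]] := pL; rewrite !scalemxAl -mulmxDl pE.
  move=> /(can_inj (mulmxKV gu)) xab.
  have xi i := congr1 (fun v : 'rV_4 => v 0 i) xab.
  have := xi 0; have := xi 1; have := xi 2; have := xi 3.
  rewrite !mxE !(tnth_nth 0) /= !mulr0 !addr0 !add0r => x3E x2E x1E x0E.
  apply: line_span => //.
    apply/span2P; exists a, 0; rewrite scale0r addr0 scalemxAl; congr (_ *m _).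
    by apply/rowP; apply: forall4P; rewrite [RHS]mxE !row4E ?mulr0.
  apply/span2P; exists 0, b; rewrite scale0r add0r scalemxAl; congr (_ *m _).
  by apply/rowP; apply: forall4P; rewrite [RHS]mxE !row4E ?mulr0.
split; first by have [] := Wlines_Wline gu x0.
by apply/span2P; exists 1, 1; rewrite !scale1r -mulmxDl -xE.
Qed.

Lemma mem_plane (h v : 'rV[k]_4) : (v \in plane_of h) = (v *m h^T == 0).
Proof. by rewrite memv_ker lfunE. Qed.

Lemma span2_sub (u v : 'rV[k]_4) (U : {vspace 'rV[k]_4}) :
  (<<[:: u; v]>> <= U)%VS = (u \in U) && (v \in U).
Proof. by rewrite span_cons span_seq1 subv_add -!memvE. Qed.

Lemma mem_plane_coords (g : 'M[k]_4) (eta x : 'rV[k]_4) : g \in unitmx ->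
  (x *m invmx g \in plane_of (eta *m g^T)) =
  (x 0 0 * eta 0 0 + x 0 1 * eta 0 1 + x 0 2 * eta 0 2 + x 0 3 * eta 0 3 == 0).
Proof.
move=> gu; rewrite mem_plane trmx_mul trmxK mulmxA mulmxKV //.
apply/eqP/eqP => [/matrixP/(_ 0 0)|E].
  by rewrite !mxE sum4E !mxE.
by apply/matrixP => i j; rewrite !ord1 !mxE sum4E !mxE.
Qed.

(** The plane cuts each of the two edges in one point, and a line of the congruence inside the plane
    must join these points. *)
Lemma Wline_in_plane (g : 'M[k]_4) (eta : 'rV[k]_4) L : g \in unitmx ->
  (forall i, eta 0 i != 0) ->
  Wlines g L /\ (L <= plane_of (eta *m g^T))%VS <->
  L = Wline g (row4 (eta 0 1) (- eta 0 0) (eta 0 3) (- eta 0 2)).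
Proof.
move=> gu eta0; set x := row4 _ _ _ _.
have x0 : Wpsi x != 0 by rewrite Wpsi_neq0 !row4E !eta0.
have frx : free [:: row4 (x 0 0) (x 0 1) 0 0 *m invmx g;
                    row4 0 0 (x 0 2) (x 0 3) *m invmx g].
  apply: free_mulmx; rewrite ?unitmx_inv //; apply/free_minor6.
  by rewrite minor6_Wline.
split=> [[/(WlinesP _ gu)[t t0 ->]]|->].
  have [[dL _ _] _] := Wlines_Wline gu t0.
  rewrite span2_sub !mem_plane_coords // !row4E !mul0r !addr0 !add0r.
  move=> /andP[/eqP t01 /eqP t23]; move: t0; rewrite Wpsi_neq0.
  (* The solutions (a, b) of a c + b d = 0 are proportional to (d, -c). *)
  have sol (a b c d : k) : c != 0 -> d != 0 -> (a != 0) || (b != 0) ->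
      a * c + b * d = 0 -> exists s, d = s * a /\ - c = s * b.
    move=> c0 d0 ab E; have b0 : b != 0.
      apply: contraTneq ab => b0; move: E; rewrite b0 mul0r addr0 => /eqP.
      by rewrite mulf_eq0 (negPf c0) orbF => ->; rewrite eqxx.
    exists (- c / b); split; last by rewrite divfK.
    by apply: (mulfI b0); rewrite -[LHS]subr0 -E; field.
  move=> /andP[ab cd].
  have [s [s0 s1]] := sol _ _ _ _ (eta0 0) (eta0 1) ab t01.
  have [s' [s2 s3]] := sol _ _ _ _ (eta0 2) (eta0 3) cd t23.
  apply: line_span => //.
    apply/span2P; exists s, 0; rewrite scale0r addr0 scalemxAl; congr (_ *m _).
    by apply/rowP; apply: forall4P; rewrite [RHS]mxE !row4E ?mulr0.
  apply/span2P; exists 0, s'; rewrite scale0r add0r scalemxAl; congr (_ *m _).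
  by apply/rowP; apply: forall4P; rewrite [RHS]mxE !row4E ?mulr0.
split; first by have [] := Wlines_Wline gu x0.
rewrite span2_sub !mem_plane_coords // !row4E.
by apply/andP; split; apply/eqP; ring.
Qed.

(** With p01 = p02 = p03 = 0 the Plücker relation is automatic, so every nonzero (p, q, r) is
    realized; the basis depends on which entry can be divided by. *)
Lemma Blines_exists (g : 'M[k]_4) (p q r : k) (psi := row6 0 0 0 p q r) :
  g \in unitmx -> psi != 0 -> exists L, Blines g L /\
    exists2 c, c != 0 & psi = c *: minor6 (coordL g L).
Proof.
move=> gu psi0.
have [x [y xy]] : exists x y : 'rV[k]_4, minor6 (col_mx x y) = psi.
  have := psi0; rewrite row6_neq0 eqxx /= => /orP[p0|/orP[q0|r0]].
  - exists (row4 0 1 0 (- (r / p))), (row4 0 0 p q).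
    by rewrite /minor6 /minor2 !col_mx2E !row4E; congr row6; field.
  - exists (row4 0 1 (r / q) 0), (row4 0 0 p q).
    by rewrite /minor6 /minor2 !col_mx2E !row4E; congr row6; field.
  - exists (row4 0 (q / r) 1 0), (row4 0 (- p) 0 r).
    by rewrite /minor6 /minor2 !col_mx2E !row4E; congr row6; field.
rewrite -xy in psi0; have [dL [c c0 E]] := line_of_coords gu psi0.
eexists; split; last by exists c; rewrite // -xy E.
move: E; rewrite xy row6Z => /row6_inj[[p1 p2 p3] _].
by split=> //; split; apply: (mulfI c0); rewrite mulr0.
Qed.

(** The intersection of x = 0 with the plane [eta], spanned by its points on the edges x = w = 0 and
    x = y = 0. *)
Definition Bline (g : 'M[k]_4) (eta : 'rV[k]_4) : {vspace 'rV[k]_4} :=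
  let u := row4 0 (eta 0 2) (- eta 0 1) 0 *m invmx g in
  let v := row4 0 0 (eta 0 3) (- eta 0 2) *m invmx g in
  <<[:: u; v]>>%VS.

Definition Bpsi (eta : 'rV[k]_4) : 'rV[k]_6 :=
  row6 0 0 0 (eta 0 2 * eta 0 3) (- (eta 0 2 * eta 0 2)) (eta 0 1 * eta 0 2).

Lemma Blines_Bline (g : 'M[k]_4) (eta : 'rV[k]_4) : g \in unitmx ->
  (forall i, eta 0 i != 0) ->
  Blines g (Bline g eta) /\
  exists2 c, c != 0 & Bpsi eta = c *: minor6 (coordL g (Bline g eta)).
Proof.
move=> gu eta0.
have E : minor6 (col_mx (row4 0 (eta 0 2) (- eta 0 1) 0)
    (row4 0 0 (eta 0 3) (- eta 0 2))) = Bpsi eta.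
  by rewrite /minor6 /minor2 !col_mx2E !row4E; congr row6; ring.
have psi0 : Bpsi eta != 0 by rewrite row6_neq0 mulf_eq0 !negb_or !eta0 ?orbT.
rewrite -E in psi0; have [dL [c c0 cE]] := line_of_coords gu psi0.
rewrite E in cE; split; last by exists c.
move: cE; rewrite row6Z => /row6_inj[[p1 p2 p3] _].
by split=> //; split; apply: (mulfI c0); rewrite mulr0.
Qed.

Lemma Bline_in_plane (g : 'M[k]_4) (eta : 'rV[k]_4) L : g \in unitmx ->
  (forall i, eta 0 i != 0) ->
  Blines g L /\ (L <= plane_of (eta *m g^T))%VS <-> L = Bline g eta.
Proof.
move=> gu eta0; have [bL _] := Blines_Bline gu eta0; have [dB _] := bL.
split=> [[bL' /subvP Lh]|->]; last first.
  split=> //; rewrite span2_sub !mem_plane_coords // !row4E.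
  by apply/andP; split; apply/eqP; ring.
apply/eqP; rewrite eqEdim dB bL'.1 leqnn andbT; apply/subvP => v vL.
have vE : v = (v *m g) *m invmx g by rewrite mulmxK.
have := Lh v vL; rewrite {1}vE mem_plane_coords //.
have [/= _ v0] : True /\ (v *m g) 0 0 = 0.
  split=> //; have [dL' _] := bL'; have /(memv_basis_mx _ dL')[c ->] := vL.
  rewrite -mulmxA -/(coordL g L) mxE sum2E.
  by rewrite !(Blines_coord0 _ gu bL') !mulr0 addr0.
move: (v *m g) v0 vE => x x0 ->; rewrite x0 mul0r add0r => /eqP xE.
(* Coordinates 1 and 3 dictate the two coefficients; coordinate 2 then agrees by the equation of the
   plane. *)
apply/span2P; exists (x 0 1 / eta 0 2), (- (x 0 3 / eta 0 2)).
rewrite !scalemxAl -mulmxDl; congr (_ *m _); apply/rowP.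
apply: forall4P; rewrite !mxE !(tnth_nth 0) /=.
- by rewrite x0; ring.
- by field; rewrite eta0.
- apply: (mulfI (eta0 2)); rewrite -[LHS]subr0 -xE; field; rewrite ?eta0 //.
- by field; rewrite eta0.
Qed.

End Families.

(** * Zero patterns, counting of lines and the order *)

Section Counting.
Context {k : fieldType}.

(* The pairs a, b for which p_ab vanishes on the component u. *)
Definition zero_pattern (u : 'I_3 + 'I_4) (a b : 'I_4) : bool :=
  match u with
  | inl i => let t := tperm 1 (lift 0 i) in (t a)./2 == (t b)./2
  | inr j => [|| a == b, a == j | b == j]
  end.

(** A congruence forces two opposite edges of the tetrahedron, a beta-plane the three edges at a
    vertex, and none of these seven sets contains another. Halving separates {0, 1} from {2, 3}. *)
Lemma zero_pattern_inj u v :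
  (forall a b, zero_pattern v a b -> zero_pattern u a b) -> v = u.
Proof.
move=> H; move: (H 0 1) (H 0 2) (H 0 3) (H 1 2) (H 1 3) (H 2 3) => {H}.
by case: u => [i|j]; [move: i; apply: forall3P | move: j; apply: forall4P];
  (case: v => [i'|j']; [move: i'; apply: forall3P | move: j'; apply: forall4P]);
  rewrite /zero_pattern ?lift03E ?permE //= => *; exfalso; auto.
Qed.

Lemma minor2_Wframe (g : 'M[k]_4) L i a b (t := tperm 1 (lift 0 i)) :
  minor2 (coordL g L) a b = minor2 (coordL (Wframe g i) L) (t a) (t b).
Proof. by rewrite minor2_xcol !tpermK. Qed.

Lemma bitcomp_zero (g : 'M[k]_4) u L a b :
  bitcomp g u L -> zero_pattern u a b -> minor2 (coordL g L) a b = 0.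
Proof.
case: u => [i|j] /=.
  rewrite (minor2_Wframe g L i); set t := tperm _ _ => -[_ p01 p23].
  move: (t a) (t b) => {}a {}b; move: a; apply: forall4P; move: b;
    apply: forall4P => //= _; rewrite ?minor2xx // minor2C ?p01 ?p23 oppr0 //.
rewrite -/(bitcomp g (inr j) L) => /bitcomp_inrP[_ pj].
case/or3P => /eqP->; first by rewrite minor2xx.
  exact: pj.
by rewrite minor2C pj oppr0.
Qed.

(** The four coordinates that are not forced to vanish are products of two entries of t. *)
Lemma Wline_nonzero (g : 'M[k]_4) i (t : 'rV[k]_4) a b : g \in unitmx ->
  (forall j, t 0 j != 0) ->
  minor2 (coordL g (Wline (Wframe g i) t)) a b = 0 ->
  zero_pattern (inl i) a b.
Proof.
move=> gu t0; rewrite (minor2_Wframe g _ i) /=; set s := tperm _ _.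
have psi0 : Wpsi t != 0 by rewrite Wpsi_neq0 !t0.
have [_ [c c0]] := Wlines_Wline (Wframe_unit i gu) psi0.
move: (coordL _ _) => N; rewrite row6Z => /row6_inj[[_ p02 p03] [p12 p13 _]].
have nz x y e : t 0 x * t 0 y = c * e -> e <> 0.
  by move=> E e0; have := mulf_neq0 (t0 x) (t0 y); rewrite E e0 mulr0 eqxx.
move/nz in p02; move/nz in p03; move/nz in p12; move/nz in p13.
move: (s a) (s b) => {}a {}b; move: a; apply: forall4P; move: b;
  apply: forall4P => //=; by rewrite // minor2C => /eqP; rewrite oppr_eq0 => /eqP.
Qed.

Lemma Bline_nonzero (g : 'M[k]_4) j (eta : 'rV[k]_4) a b : g \in unitmx ->
  (forall i, eta 0 i != 0) ->
  minor2 (coordL g (Bline (Bframe g j) eta)) a b = 0 ->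
  zero_pattern (inr j) a b.
Proof.
move=> gu eta0 /=.
have -> : minor2 (coordL g (Bline (Bframe g j) eta)) a b =
    minor2 (coordL (Bframe g j) (Bline (Bframe g j) eta))
      (tperm 0 j a) (tperm 0 j b) by rewrite minor2_xcol !tpermK.
have -> : [|| a == b, a == j | b == j] = [|| tperm 0 j a == tperm 0 j b,
    tperm 0 j a == 0 | tperm 0 j b == 0].
  by rewrite (inj_eq perm_inj) !(can2_eq (tpermK 0 j) (tpermK 0 j)) tpermL.
have [_ [c c0]] := Blines_Bline (Bframe_unit j gu) eta0.
move: (coordL _ _) => N; rewrite row6Z => /row6_inj[_ [p12 p13 p23]].
have nz x e : x = c * e -> x != 0 -> e <> 0.
  by move=> -> x0 e0; move: x0; rewrite e0 mulr0 eqxx.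
move/nz in p12; move/nz in p13; move/nz in p23.
rewrite oppr_eq0 in p13.
have {}p12 := p12 (mulf_neq0 (eta0 _) (eta0 _)).
have {}p13 := p13 (mulf_neq0 (eta0 _) (eta0 _)).
have {}p23 := p23 (mulf_neq0 (eta0 _) (eta0 _)).
move: (tperm 0 j a) (tperm 0 j b) => {}a {}b; move: a; apply: forall4P; move: b;
  apply: forall4P => //=; by rewrite // minor2C => /eqP; rewrite oppr_eq0 => /eqP.
Qed.

Lemma num_lines_image (I : finType) (l : I -> {vspace 'rV[k]_4}) Z n :
  #|I| = n -> injective l -> (forall L, Z L <-> exists u, L = l u) ->
  num_lines Z n.
Proof.
move=> <- l_inj ZE; exists [seq l u | u <- enum I]; split.
- by rewrite map_inj_uniq ?enum_uniq.
- by rewrite size_map cardE.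
- move=> L; rewrite ZE; split=> [/mapP[u _ ->]|[u ->]]; first by exists u.
  by apply: map_f; rewrite mem_enum.
Qed.

Lemma num_lines1 (L0 : {vspace 'rV[k]_4}) Z : (forall L, Z L <-> L = L0) ->
  num_lines Z 1.
Proof.
by move=> ZE; exists [:: L0]; split=> // L; rewrite inE ZE; split=> /eqP.
Qed.

Lemma num_lines0 (Z : @lineset k) : (forall L, ~ Z L) -> num_lines Z 0.
Proof. by move=> ZE; exists [::]; split=> // L; split=> // /ZE. Qed.

(** The open set is the complement of the faces of a tetrahedron, cut out by the product of four
    linear forms; it is generic enough for every order and class below. *)
Lemma general_point_coords (A : 'M[k]_4) (P : 'rV[k]_4 -> Prop) :
  A \in unitmx -> (forall p, (forall i, (p *m A) 0 i != 0) -> P p) ->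
  general_point P.
Proof.
move=> Au PA; exists 4, (pullback A ('X_0 * 'X_1 * 'X_2 * 'X_3)).
have E p : evalv (pullback A ('X_0 * 'X_1 * 'X_2 * 'X_3)) p =
    (p *m A) 0 0 * (p *m A) 0 1 * (p *m A) 0 2 * (p *m A) 0 3.
  by rewrite evalv_pullback !evalvM /evalv !mevalXU.
split.
- have X1 i : ('X_i : {mpoly k[4]}) \is 1.-homog by rewrite dhomogX /= mdeg1.
  apply: dhomog_pullback.
  exact: (dhomogM (dhomogM (dhomogM (X1 0) (X1 1)) (X1 2)) (X1 3)).
- apply: contraNneq (oner_neq0 k) => F0.
  have := E (const_mx 1 *m invmx A); rewrite F0 /evalv meval0 mulmxKV // !mxE.
  by rewrite !mulr1 => <-.
- move=> p p0; rewrite E !mulf_eq0 !negb_or => /andP[/andP[/andP[x0 x1] x2] x3].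
  by apply: PA; exact: forall4P.
Qed.

Lemma Wframe_coords (g : 'M[k]_4) i (p : 'rV[k]_4) :
  (forall j, (p *m g) 0 j != 0) -> forall j, (p *m Wframe g i) 0 j != 0.
Proof.
move=> p0 j; rewrite /Wframe xcolE mulmxA -xcolE mxE; exact: p0.
Qed.

Lemma order_Wlines (g : 'M[k]_4) : g \in unitmx -> has_order (Wlines g) 1.
Proof.
move=> gu; apply: (general_point_coords gu) => p p0.
apply: num_lines1 => L; apply: Wline_through => //.
by rewrite Wpsi_neq0 !p0.
Qed.

Lemma Blines_through (g : 'M[k]_4) L p : g \in unitmx ->
  Blines g L -> p \in L -> (p *m g) 0 0 = 0.
Proof.
move=> gu bL; have [dL _] := bL => /(memv_basis_mx _ dL)[c ->].
rewrite -mulmxA -/(coordL g L) mxE sum2E.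
by rewrite !(Blines_coord0 _ gu bL) !mulr0 addr0.
Qed.

Lemma order_Blines (g : 'M[k]_4) : g \in unitmx -> has_order (Blines g) 0.
Proof.
move=> gu; apply: (general_point_coords gu) => p p0.
apply: num_lines0 => L [bL /(Blines_through gu bL) E].
by have := p0 0; rewrite E eqxx.
Qed.

(** Off the tropes no line of a beta-plane passes through p. The other three lines differ, each
    having no zeros beyond the pattern of its own congruence. *)
Lemma order_bitcomps (g : 'M[k]_4) : g \in unitmx ->
  has_order (fun L => exists u, bitcomp g u L) 3.
Proof.
move=> gu; apply: (general_point_coords gu) => p p0.
pose l i := Wline (Wframe g i) (p *m Wframe g i).
have lP i L : bitcomp g (inl i) L /\ p \in L <-> L = l i.
  apply: Wline_through; first exact: Wframe_unit.
  by rewrite Wpsi_neq0 !Wframe_coords.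
apply: (num_lines_image (l := l)); first exact: card_ord.
  move=> i j lij; suff [] : inl j = inl i :> 'I_3 + 'I_4 by [].
  apply: zero_pattern_inj => a b /bitcomp_zero z.
  have [/z lj0 _] := (lP j (l j)).2 erefl.
  by apply: (Wline_nonzero gu (Wframe_coords i p0)); rewrite -/(l i) lij.
move=> L; split=> [[[[i|j] cL] pL]|[i /lP[cL pL]]].
- by exists i; apply/lP.
- have E := Blines_through (Bframe_unit j gu) cL pL.
  have := p0 (tperm 0 j 0); move: E.
  by rewrite /Bframe xcolE mulmxA -xcolE mxE => ->; rewrite eqxx.
- by split=> //; exists (inl i).
Qed.

End Counting.

(** * Class and dimension *)

Section Class.
Context {k : fieldType}.

Lemma plane_xcol s t (g : 'M[k]_4) (eta : 'rV[k]_4) :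
  eta *m g^T = xcol s t eta *m (xcol s t g)^T.
Proof.
rewrite !xcolE trmx_mul tr_tperm_mx mulmxA -(mulmxA eta) -perm_mxM tperm2.
by rewrite perm_mx1 mulmx1.
Qed.

Lemma xcol_neq0 s t (eta : 'rV[k]_4) : (forall i, eta 0 i != 0) ->
  forall i, xcol s t eta 0 i != 0.
Proof. by move=> eta0 i; rewrite mxE. Qed.

Definition plane_line (g : 'M[k]_4) (eta : 'rV[k]_4) (u : 'I_3 + 'I_4) :
    {vspace 'rV[k]_4} :=
  match u with
  | inl i => let e := xcol 1 (lift 0 i) eta in
             Wline (Wframe g i) (row4 (e 0 1) (- e 0 0) (e 0 3) (- e 0 2))
  | inr j => Bline (Bframe g j) (xcol 0 j eta)
  end.

Lemma plane_lineP (g : 'M[k]_4) (eta : 'rV[k]_4) u L : g \in unitmx ->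
  (forall i, eta 0 i != 0) ->
  bitcomp g u L /\ (L <= plane_of (eta *m g^T))%VS <-> L = plane_line g eta u.
Proof.
move=> gu eta0; case: u => [i|j] /=.
  rewrite (plane_xcol 1 (lift 0 i)); apply: Wline_in_plane.
    exact: Wframe_unit.
  exact: xcol_neq0.
rewrite (plane_xcol 0 j); apply: Bline_in_plane; first exact: Bframe_unit.
exact: xcol_neq0.
Qed.

(** The line cut out by a general plane on the component u has only the zeros forced by u, so it
    lies in no other component. This separates both the seven lines in a plane and the seven
    components. *)
Lemma plane_line_comp (g : 'M[k]_4) (eta : 'rV[k]_4) u v : g \in unitmx ->
  (forall i, eta 0 i != 0) -> bitcomp g v (plane_line g eta u) -> v = u.
Proof.
move=> gu eta0 /bitcomp_zero z; apply: zero_pattern_inj => a b /z.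
case: u {z} => [i|j] /=; last by apply: Bline_nonzero => //; exact: xcol_neq0.
apply: Wline_nonzero => //; apply: forall4P; rewrite row4E ?oppr_eq0;
  exact: xcol_neq0.
Qed.

Lemma general_plane (g : 'M[k]_4) (P : 'rV[k]_4 -> Prop) : g \in unitmx ->
  (forall eta : 'rV[k]_4, (forall i, eta 0 i != 0) -> P (eta *m g^T)) ->
  general_point P.
Proof.
move=> gu Peta; have gTu : g^T \in unitmx by rewrite unitmx_tr.
apply: (@general_point_coords k (invmx g^T)); first by rewrite unitmx_inv.
by move=> h h0; rewrite -(mulmxKV gTu h); exact: Peta.
Qed.

Lemma class_bitcomp (g : 'M[k]_4) u : g \in unitmx ->
  has_class (bitcomp g u) 1.
Proof.
move=> gu; apply: (general_plane gu) => eta eta0.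
by apply: num_lines1 => L; exact: plane_lineP.
Qed.

Lemma class_bitcomps (g : 'M[k]_4) : g \in unitmx ->
  has_class (fun L => exists u, bitcomp g u L) 7.
Proof.
move=> gu; apply: (general_plane gu) => eta eta0.
apply: (num_lines_image (l := plane_line g eta)).
- by rewrite card_sum !card_ord.
- move=> u v uv; apply/esym/(plane_line_comp gu eta0 (u := u) (v := v)).
  by rewrite uv; have [] := (plane_lineP v (plane_line g eta v) gu eta0).2 erefl.
- move=> L; split=> [[[u cL] Lh]|[u /(plane_lineP _ _ gu eta0)[cL Lh]]].
    by exists u; apply/plane_lineP.
  by split=> //; exists u.
Qed.

Lemma bitcomp_sub_inj (g : 'M[k]_4) u v : g \in unitmx ->
  (forall L, bitcomp g u L -> bitcomp g v L) -> u = v.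
Proof.
move=> gu uv; pose eta : 'rV[k]_4 := const_mx 1.
have eta0 i : eta 0 i != 0 by rewrite mxE oner_eq0.
apply/esym/(plane_line_comp gu eta0 (u := u))/uv.
by have [] := (plane_lineP u (plane_line g eta u) gu eta0).2 erefl.
Qed.

(* Three hyperplanes missing every component: p23 = p01 + p02,
   p13 = p02 + p03 and p12 = p03 + p01. *)
Lemma bitcomps_dim_le2 (g : 'M[k]_4) (Z : @lineset k) : g \in unitmx ->
  (forall L, Z L -> exists u, bitcomp g u L) ->
  exists H : 'I_3 -> 'rV[k]_6, ~ meets_hyperplanes Z H.
Proof.
move=> gu Zsub.
pose h (i : 'I_3) : 'rV[k]_6 :=
  tnth [tuple row6 (-1) (-1) 0 0 0 1; row6 0 (-1) (-1) 0 1 0;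
              row6 (-1) 0 (-1) 1 0 0] i.
exists (fun i => h i *m (wedge g)^T) => -[L [/Zsub[u cL] LH]].
have dL := bitcomp_is_line cL.
have {}LH i : minor6 (coordL g L) *m (h i)^T = 0.
  by rewrite minor6_coordL -(LH i) trmx_mul trmxK mulmxA.
have := LH 0; have := LH 1; have := LH 2; rewrite /h !(tnth_nth 0) /=.
rewrite !(row6_dotP _ _ _ _ _ _ (erefl (minor6 _))) => {LH} l2 l1 l0.
have pr := plucker_relation (coordL g L).
have := coordL_neq0 gu dL; rewrite /minor6.
have z a b := @bitcomp_zero _ g u L a b cL.
move: (minor2 _ 0 1) (minor2 _ 0 2) (minor2 _ 0 3) (minor2 _ 1 2)
  (minor2 _ 1 3) (minor2 _ 2 3) (z 0 1) (z 0 2) (z 0 3) (z 1 2) (z 1 3) (z 2 3)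
  l0 l1 l2 pr => a1 b1 c1 c2 b2 a2 z01 z02 z03 z12 z13 z23 l0 l1 l2.
have a2E : a2 = a1 + b1 by apply/eqP; rewrite -subr_eq0 -l0; apply/eqP; ring.
have b2E : b2 = b1 + c1 by apply/eqP; rewrite -subr_eq0 -l1; apply/eqP; ring.
have c2E : c2 = c1 + a1 by apply/eqP; rewrite -subr_eq0 -l2; apply/eqP; ring.
move: z01 z02 z03 z12 z13 z23; rewrite {}a2E {}b2E {}c2E {z cL l0 l1 l2}.
move=> Z1 Z2 Z3 Z4 Z5 Z6 pr /eqP; apply.
suff [-> -> ->] : [/\ a1 = 0, b1 = 0 & c1 = 0] by rewrite !addr0 row6_0.
have sq0 (x : k) : x ^+ 2 = 0 -> x = 0.
  by move=> /eqP; rewrite expf_eq0 => /eqP.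
(* On a congruence, its two zeros and the linear equations leave one unknown, whose square is the
   Plücker relation up to sign. On a beta-plane the three zeros and the linear equations suffice. *)
move: Z1 Z2 Z3 Z4 Z5 Z6; case: u => [i|j].
  move: i; apply: forall3P; rewrite /zero_pattern ?lift03E ?permE /=.
  - move=> /(_ isT) a0 _ _ _ _ /(_ isT); rewrite a0 add0r => b0.
    by split=> //; apply: sq0; rewrite -[RHS]pr a0 b0; ring.
  - move=> _ /(_ isT) b0 _ _ /(_ isT) + _; rewrite b0 add0r => c0.
    by split=> //; apply: sq0; rewrite -[RHS]pr b0 c0; ring.
  - move=> _ _ /(_ isT) c0 /(_ isT) + _ _; rewrite c0 add0r => a0.
    by split=> //; apply: sq0; rewrite -[RHS]oppr0 -pr a0 c0; ring.
move: j; apply: forall4P; rewrite /zero_pattern /=.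
- by move=> /(_ isT) -> /(_ isT) -> /(_ isT) ->.
- move=> /(_ isT) a0 _ _ /(_ isT) + /(_ isT) + _.
  by rewrite a0 addr0 => ->; rewrite addr0 => ->.
- move=> _ /(_ isT) b0 _ /(_ isT) + _ /(_ isT).
  by rewrite b0 addr0 => + a0; rewrite a0 addr0.
- move=> _ _ /(_ isT) c0 _ /(_ isT) + /(_ isT).
  by rewrite c0 addr0 => ->; rewrite addr0 => ->.
Qed.

End Class.

(** * Irreducibility, dimension and bidegree of the components *)

Section Dimension.
Context {k : closedFieldType}.

Lemma polyfun_row6 n (a b c d e f : 'rV[k]_n -> k) :
  polyfun a -> polyfun b -> polyfun c -> polyfun d -> polyfun e -> polyfun f ->
  forall j, polyfun (fun t => row6 (a t) (b t) (c t) (d t) (e t) (f t) 0 j).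
Proof.
move=> pa pb pc pd pe pf j.
have [p pP] : polyfun (fun t => nth 0 [:: a t; b t; c t; d t; e t; f t] j).
  by case: j => [[|[|[|[|[|[|j]]]]]] Hj] //=; exact: polyfun_const.
by exists p => t; rewrite -pP mxE (tnth_nth 0).
Qed.

Lemma polyfun_Wpsi j : polyfun (fun t : 'rV[k]_4 => Wpsi t 0 j).
Proof.
by apply: polyfun_row6; (exact: polyfun_const ||
  (apply: polyfunM; exact: polyfun_coord)).
Qed.

Lemma irreducible_Wlines (g : 'M[k]_4) : g \in unitmx ->
  irreducible_lines (Wlines g).
Proof.
move=> gu; apply: (irreducible_param gu polyfun_Wpsi).
- by move=> L [].
- move=> L /(WlinesP _ gu)[t t0 ->].
  by have [_ [c c0 cE]] := Wlines_Wline gu t0; exists t, c.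
- move=> t t0; have [WL [c c0 cE]] := Wlines_Wline gu t0.
  by exists (Wline g t), c.
- exists (Wline g (row4 1 1 1 1)).
  have t0 : Wpsi (row4 1 1 1 1 : 'rV[k]_4) != 0.
    by rewrite Wpsi_neq0 !row4E oner_eq0.
  by have [] := Wlines_Wline gu t0.
Qed.

Lemma irreducible_Blines (g : 'M[k]_4) : g \in unitmx ->
  irreducible_lines (Blines g).
Proof.
move=> gu.
apply: (@irreducible_param k 3 g
  (fun t => row6 0 0 0 (t 0 0) (t 0 1) (t 0 2)) _ gu).
- by apply: polyfun_row6; (exact: polyfun_const || exact: polyfun_coord).
- by move=> L [].
- move=> L [dL [p1 p2 p3]]; set N := coordL g L in p1 p2 p3 *.
  exists (\row_i tnth [tuple minor2 N 1 2; minor2 N 1 3; minor2 N 2 3] i), 1.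
  rewrite oner_neq0; split=> //.
  by rewrite scale1r /minor6 p1 p2 p3 !mxE !(tnth_nth 0).
- move=> t t0; have [L [BL [c c0 cE]]] := Blines_exists gu t0.
  by exists L, c.
- have psi0 : row6 0 0 0 1 0 0 != 0 :> 'rV[k]_6.
    by rewrite row6_neq0 oner_eq0 !orbT.
  by have [L [BL _]] := Blines_exists gu psi0; exists L.
Qed.

Lemma irreducible_bitcomp (g : 'M[k]_4) u : g \in unitmx ->
  irreducible_lines (bitcomp g u).
Proof.
by case: u => ? gu; [apply: irreducible_Wlines; exact: Wframe_unit
  | apply: irreducible_Blines; exact: Bframe_unit].
Qed.

Lemma quadratic_zero (A B C : k) : exists s t,
  (s != 0) || (t != 0) /\ A * s ^+ 2 + B * (s * t) + C * t ^+ 2 = 0.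
Proof.
have [p [q [r [s [-> -> ->]]]]] := quadratic_factor A B C.
have [pq|] := boolP ((q != 0) || (p != 0)).
  by exists q, (- p); rewrite oppr_eq0; split=> //; ring.
rewrite negb_or !negbK => /andP[/eqP-> /eqP->].
by exists 1, 0; rewrite oner_eq0; split=> //; ring.
Qed.

Lemma hyperplane_coords (g : 'M[k]_4) (h : 'rV[k]_6) L : g \in unitmx ->
  minor6 (coordL g L) *m (h *m (wedge (invmx g))^T)^T = plucker L *m h^T.
Proof.
move=> gu; rewrite trmx_mul trmxK minor6_coordL mulmxA.
by rewrite -(mulmxA (plucker L)) wedgeK // mulmx1.
Qed.

Lemma Wlines_meets (g : 'M[k]_4) (H : 'I_2 -> 'rV[k]_6) : g \in unitmx ->
  meets_hyperplanes (Wlines g) H.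
Proof.
move=> gu; pose h i := H i *m (wedge (invmx g))^T.
have [a0 [b0 [c0 [d0 [e0 [f0 h0]]]]]] := row6_eta (h 0).
have [a1 [b1 [c1 [d1 [e1 [f1 h1]]]]]] := row6_eta (h 1).
(* On P^1 x P^1 the two hyperplanes are bilinear equations. For fixed (s, t) they are linear in (x,
   y), and this quadratic form in (s, t) is their determinant. *)
have [s [t [st E]]] := quadratic_zero (b0 * c1 - b1 * c0)
  (b0 * e1 + d0 * c1 - b1 * e0 - d1 * c0) (d0 * e1 - d1 * e0).
have [|x [y [xy [E0 E1]]]] := @singular2 _ (s * b0 + t * d0) (s * c0 + t * e0)
  (s * b1 + t * d1) (s * c1 + t * e1).
  by rewrite -[RHS]E; ring.
have v0 : Wpsi (row4 s t x y) != 0 by rewrite Wpsi_neq0 !row4E st.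
have [WL [c cn0 cE]] := Wlines_Wline gu v0.
exists (Wline g (row4 s t x y)); split=> // i.
rewrite -(hyperplane_coords _ _ gu) -/(h i).
suff Ei : Wpsi (row4 s t x y) *m (h i)^T = 0.
  apply: (scalerI cn0); rewrite scaler0 scalemxAl -cE; exact: Ei.
rewrite /Wpsi !row4E; move: i; apply: forall2P.
  rewrite h0; apply/(row6_dotP _ _ _ _ _ _ erefl); rewrite -[RHS]E0; ring.
rewrite h1; apply/(row6_dotP _ _ _ _ _ _ erefl); rewrite -[RHS]E1; ring.
Qed.

Lemma Blines_meets (g : 'M[k]_4) (H : 'I_2 -> 'rV[k]_6) : g \in unitmx ->
  meets_hyperplanes (Blines g) H.
Proof.
move=> gu; pose h i := H i *m (wedge (invmx g))^T.
have [a0 [b0 [c0 [d0 [e0 [f0 h0]]]]]] := row6_eta (h 0).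
have [a1 [b1 [c1 [d1 [e1 [f1 h1]]]]]] := row6_eta (h 1).
have [p [q [r [pqr [E0 E1]]]]] : exists p q r : k,
    [|| p != 0, q != 0 | r != 0] /\
    p * d0 + q * e0 + r * f0 = 0 /\ p * d1 + q * e1 + r * f1 = 0.
  (* The cross product of the two equations solves both. If it vanishes, the equations are dependent
     and a solution is read off from a nonzero pair of coefficients. *)
  have [ne|] := boolP [|| e0 * f1 - f0 * e1 != 0, f0 * d1 - d0 * f1 != 0
                        | d0 * e1 - e0 * d1 != 0].
    by do 3!eexists; split; [exact: ne | split; ring].
  rewrite !negb_or !negbK => /and3P[/eqP ef /eqP fd /eqP de].
  have [de0 | ] := boolP ((e0 != 0) || (d0 != 0)).
    exists e0, (- d0), 0; rewrite oppr_eq0 eqxx orbF; split=> //.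
    by split; [ring | rewrite -[RHS]oppr0 -[in RHS]de; ring].
  rewrite negb_or !negbK => /andP[/eqP e00 /eqP d00].
  have [de1 | ] := boolP ((e1 != 0) || (d1 != 0)).
    exists e1, (- d1), 0; rewrite oppr_eq0 eqxx orbF; split=> //.
    by split; rewrite ?e00 ?d00; ring.
  rewrite negb_or !negbK => /andP[/eqP e10 /eqP d10].
  by exists 1, 0, 0; rewrite oner_eq0 e00 d00 e10 d10; split=> //; split; ring.
have v0 : row6 0 0 0 p q r != 0 by rewrite row6_neq0 eqxx.
have [L [BL [c cn0 cE]]] := Blines_exists gu v0.
exists L; split=> // i; rewrite -(hyperplane_coords _ _ gu) -/(h i).
suff Ei : row6 0 0 0 p q r *m (h i)^T = 0.
  apply: (scalerI cn0); rewrite scaler0 scalemxAl -cE; exact: Ei.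
move: i; apply: forall2P.
  rewrite h0; apply/(row6_dotP _ _ _ _ _ _ erefl); rewrite -[RHS]E0; ring.
rewrite h1; apply/(row6_dotP _ _ _ _ _ _ erefl); rewrite -[RHS]E1; ring.
Qed.

Lemma bitcomp_meets (g : 'M[k]_4) u (H : 'I_2 -> 'rV[k]_6) : g \in unitmx ->
  meets_hyperplanes (bitcomp g u) H.
Proof.
by case: u => ? gu; [apply: Wlines_meets; exact: Wframe_unit
  | apply: Blines_meets; exact: Bframe_unit].
Qed.

Lemma bidegree_bitcomp (g : 'M[k]_4) u : g \in unitmx ->
  bidegree (bitcomp g u) (if u is inl _ then 1 else 0) 1.
Proof.
move=> gu; split; [split; [|split]| |].
- exact: closed_comp.
- by move=> H; exact: bitcomp_meets.
- by apply: (bitcomps_dim_le2 gu) => L cL; exists u.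
- by case: u => ?; [apply: order_Wlines; exact: Wframe_unit
    | apply: order_Blines; exact: Bframe_unit].
- exact: class_bitcomp.
Qed.

Lemma bidegree_bitcomps (g : 'M[k]_4) : g \in unitmx ->
  bidegree (fun L => exists u, bitcomp g u L) 3 7.
Proof.
move=> gu; split; [split; [|split]| |].
- have cU := closed_cover (enum {: 'I_3 + 'I_4}) (closed_comp g).
  apply: same_lines_closed cU => L.
  by split=> -[u]; [exists u | exists u; rewrite // mem_enum].
- move=> H; have [L [cL LH]] := bitcomp_meets (inl 0) H gu.
  by exists L; split=> //; exists (inl 0).
- exact: (bitcomps_dim_le2 gu).
- exact: order_bitcomps.
- exact: class_bitcomps.
Qed.

End Dimension.

(** * Tropes *)

Section Planes.
Context {k : fieldType}.

Lemma dim_plane_of (h : 'rV[k]_4) : h != 0 -> is_plane (plane_of h).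
Proof.
move=> h0; have := limg_ker_dim (linfun (mulmxr h^T : 'rV[k]_4 -> 'rV[k]_1))
  fullv.
rewrite capfv -/(plane_of h) dimvf /dim /= mul1n.
set d := \dim (_ @: _); suff -> : d = 1%N by rewrite addn1 => -[].
apply/eqP; rewrite eqn_leq; apply/andP; split.
  by rewrite (leq_trans (dimvS (subvf _))) // dimvf /dim /= mul1n.
rewrite lt0n dimv_eq0; apply: contraNneq h0 => im0.
apply/eqP/rowP => i; rewrite mxE.
have : linfun (mulmxr h^T : 'rV[k]_4 -> 'rV[k]_1) (delta_mx 0 i) = 0.
  by apply/eqP; rewrite -memv0 -im0 memv_img // memvf.
by rewrite lfunE /= -rowE => /rowP/(_ 0); rewrite !mxE.
Qed.

Definition coord_plane (g : 'M[k]_4) (j : 'I_4) := plane_of (col j g)^T.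

Lemma mem_coord_plane (g : 'M[k]_4) j v :
  (v \in coord_plane g j) = ((v *m g) 0 j == 0).
Proof.
rewrite mem_plane trmxK colE mulmxA -colE; apply/eqP/eqP => [/colP/(_ 0)|v0].
  by rewrite !mxE.
by apply/colP => i; rewrite !ord1 mxE v0 mxE.
Qed.

Lemma coord_plane_is_plane (g : 'M[k]_4) j :
  g \in unitmx -> is_plane (coord_plane g j).
Proof.
move=> gu; apply: dim_plane_of; apply/eqP => c0.
have := congr1 (fun v : 'rV_4 => row j (invmx g) *m v^T) c0.
rewrite trmxK colE mulmxA -row_mul mulVmx // trmx0 mulmx0 => /matrixP/(_ 0 0).
by rewrite -colE !mxE eqxx => /eqP; rewrite oner_eq0.
Qed.

Lemma coord_plane_inj (g : 'M[k]_4) :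
  g \in unitmx -> injective (coord_plane g).
Proof.
move=> gu i j ij; apply/eqP; rewrite eq_sym; apply: contraT => nji.
have := mem_coord_plane g i (delta_mx 0 i *m invmx g).
rewrite ij mem_coord_plane mulmxKV // !mxE !eqxx (negPf nji).
by rewrite eqxx oner_eq0.
Qed.

Lemma Bframe_coord (g : 'M[k]_4) j (v : 'rV[k]_4) :
  (v *m Bframe g j) 0 0 = (v *m g) 0 j.
Proof. by rewrite /Bframe xcolE mulmxA -xcolE mxE tpermL. Qed.

Lemma coordL_coord_plane (g : 'M[k]_4) j L d :
  is_line L -> (L <= coord_plane g j)%VS -> coordL g L d j = 0.
Proof.
move=> dL /subvP/(_ (row d (basis_mx 2 L))).
rewrite mem_coord_plane -row_mul mxE => Lj; apply/eqP/Lj.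
by apply/(memv_basis_mx _ dL); exists (delta_mx 0 d); rewrite rowE.
Qed.

Lemma bitcomp_beta_plane (g : 'M[k]_4) j : g \in unitmx ->
  same_lines (bitcomp g (inr j)) (beta_plane (coord_plane g j)).
Proof.
move=> gu L; split=> [cL|[dL LP]].
  split; first exact: bitcomp_is_line cL.
  apply/subvP => v vL; rewrite mem_coord_plane -Bframe_coord.
  by rewrite (Blines_through (Bframe_unit j gu) cL vL).
apply/bitcomp_inrP; split=> // i.
by rewrite /minor2 !(coordL_coord_plane _ dL LP) mul0r mulr0 subrr.
Qed.

End Planes.

Section Tropes.
Context {k : closedFieldType} (k2 : 2%N \in [pchar k]).

Lemma linf_homog m (N : 'M[k]_(m, 4)) i : linf N i \is 1.-homog.
Proof.
by apply: rpred_sum => d _; apply: rpredZ; rewrite dhomogX /= mdeg1.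
Qed.

(** On x = 0 the form becomes a (zw)^2 + b (yw)^2 + c (yz)^2, the square of the conic whose
    coefficients are the square roots of a, b, c. *)
Lemma coord_plane_trope (g : 'M[k]_4) (a b c : k) j : g \in unitmx ->
  a != 0 -> b != 0 -> c != 0 ->
  trope (pullback g (kummer_form a b c)) (coord_plane g j).
Proof.
move=> gu a0 b0 c0; have dP := coord_plane_is_plane j gu; split=> //.
have [a' [b' [c' [_ _ c0' FE]]]] := Bframe_kummer k2 g j a0 b0 c0.
have gju := Bframe_unit j gu.
set B := basis_mx 3 _; pose l := linf (B *m Bframe g j).
have l0 : l 0 = 0.
  rewrite /l /linf big1 // => d _; suff -> : (B *m Bframe g j) d 0 = 0.
    by rewrite scale0r.
  have : row d B \in coord_plane g j.
    by apply/(memv_basis_mx _ dP); exists (delta_mx 0 d); rewrite rowE.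
  by rewrite mem_coord_plane -Bframe_coord -row_mul mxE => /eqP.
have [ra aE] := sqrt_exists a'; have [rb bE] := sqrt_exists b'.
have [rc cE] := sqrt_exists c'.
have hl2 i i' : l i * l i' \is 2.-homog.
  exact: (dhomogM (linf_homog _ i) (linf_homog _ i')).
pose q := ra *: (l 2 * l 3) + rb *: (l 1 * l 3) + rc *: (l 1 * l 2).
have qE : pullback B (pullback g (kummer_form a b c)) = q ^+ 2.
  rewrite FE pullbackM (pullback_kummer k2) -/l l0 !mul0r !add0r addr0.
  by rewrite !(sqrrD_char2 (mpoly_char2 k2 3)) !exprZn aE bE cE.
exists q; split=> //.
  by do ?apply: rpredD; apply: rpredZ; exact: hl2.
apply: contraNneq c0' => q0.
(* At (0, 1, 1, 0) the Kummer form takes the value c', so q cannot be zero. *)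
pose v := row4 0 1 1 0 *m invmx (Bframe g j).
have : v \in coord_plane g j.
  by rewrite mem_coord_plane -Bframe_coord mulmxKV // row4E.
move=> /(memv_basis_mx _ dP)[p pE].
have := congr1 (fun f => evalv f p) qE.
rewrite q0 expr0n FE !evalv_pullback -/B -pE mulmxKV // (evalv_kummer k2).
rewrite !row4E /evalv meval0.
by rewrite !(mulr0, mul0r, addr0, add0r, mulr1, expr0n, expr1n) => ->.
Qed.

(** The restriction of x y z w to the plane has zero differential. In characteristic 2 every trope
    satisfies this, a condition free of a, b, c. *)
Definition tangent_plane (eta : 'rV[k]_4) := forall x y : 'rV[k]_4,
  x *m eta^T = 0 -> y *m eta^T = 0 -> polar4 x y = 0.

Lemma polar4_xcol s t (x y : 'rV[k]_4) :
  polar4 (xcol s t x) (xcol s t y) = polar4 x y.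
Proof.
rewrite /polar4 !mxE; move: s; apply: forall4P; move: t; apply: forall4P;
  rewrite !permE /=; ring.
Qed.

Lemma tangent_plane_xcol s t eta :
  tangent_plane eta -> tangent_plane (xcol s t eta).
Proof.
move=> tg x y; rewrite xcolE trmx_mul tr_tperm_mx !mulmxA -!xcolE => x0 y0.
by rewrite -(polar4_xcol s t); apply: tg.
Qed.

Lemma row4_dot (a b c d : k) (eta : 'rV[k]_4) :
  a * eta 0 0 + b * eta 0 1 + c * eta 0 2 + d * eta 0 3 = 0 ->
  row4 a b c d *m eta^T = 0.
Proof.
by move=> E; apply/matrixP => i j; rewrite !ord1 !mxE sum4E -[RHS]E !mxE.
Qed.

(** At a point with z = 0 the polar is x y w times the z-coordinate of the direction. If both
    entries of [eta] were nonzero, the plane would contain a point with z = 0 and x y w nonzero, and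
    a direction with z = 1. *)
Lemma tangent_plane01 eta :
  tangent_plane eta -> eta 0 0 != 0 -> eta 0 1 = 0.
Proof.
move=> tg e0; have [//|e1] := eqVneq (eta 0 1) 0.
(* A non-root s makes coordinates 0 and 1 of the chosen point nonzero. *)
have P0 : 'X * (eta 0 0 *: 'X + (eta 0 3)%:P) != 0.
  rewrite mulf_neq0 ?polyX_eq0 //; apply: contraNneq e0 => P0.
  have := congr1 (fun p : {poly k} => p`_1) P0.
  by rewrite coefD coefZ coefX coefC coef0 mulr1 addr0 => ->.
have [s] := closed_nonrootP _ P0.
rewrite rootE hornerM hornerD hornerZ hornerX hornerC mulf_eq0 negb_or.
move=> /andP[s0 t0].
have := tg (row4 s (- (eta 0 0 * s + eta 0 3) / eta 0 1) 0 1)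
  (row4 (- eta 0 2 / eta 0 0) 0 1 0).
have -> : row4 s (- (eta 0 0 * s + eta 0 3) / eta 0 1) 0 1 *m eta^T = 0.
  by apply: row4_dot; field.
have -> : row4 (- eta 0 2 / eta 0 0) 0 1 0 *m eta^T = 0.
  by apply: row4_dot; field.
move=> /(_ erefl erefl)/eqP; rewrite /polar4 !row4E !(mulr0, mul0r, add0r, addr0).
by rewrite !mulr1 !mulf_eq0 oppr_eq0 invr_eq0 (negPf s0) (negPf t0) (negPf e1).
Qed.

Lemma tangent_plane_coord eta i j :
  tangent_plane eta -> eta 0 i != 0 -> j != i -> eta 0 j = 0.
Proof.
(* After i has been moved to position 0, j sits at position m; a second swap brings it to position
   1. *)
move=> tg ei ji; pose m := tperm 0 i j.
have m0 : m != 0.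
  by apply: contraNneq ji => m0; rewrite -(tpermK 0 i j) -/m m0 tpermL.
have := tangent_plane01 (@tangent_plane_xcol 1 m _ (@tangent_plane_xcol 0 i _ tg)).
rewrite !mxE (_ : tperm 1 m 1 = m) ?tpermL // tpermK.
by rewrite (_ : tperm 1 m 0 = 0) ?tpermL ?tpermD //; apply.
Qed.

(** On a trope the form is a square, so its derivatives and hence the polar vanish on P. This leaves
    the equation of P with a single nonzero coordinate. *)
Lemma trope_coord_plane (g : 'M[k]_4) (a b c : k) P : g \in unitmx ->
  trope (pullback g (kummer_form a b c)) P -> exists j, P = coord_plane g j.
Proof.
move=> gu [dP [q [_ _ qE]]]; set B := basis_mx 3 P in qE.
pose N := B *m g.
have D0 d : (pullback N (kummer_form a b c))^`M(d) = 0.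
  by rewrite -pullbackM qE mderiv_sqr.
(* The equation of P in the frame g; it exists because the 4 x 3 matrix N^T has rank at most 3. *)
have [eta eta0 etaN] : exists2 eta : 'rV[k]_4, eta != 0 & eta *m N^T = 0.
  have /rowV0Pn[v /sub_kermxP vN v0] : kermx N^T != 0.
    rewrite -mxrank_eq0 mxrank_ker subn_eq0 -ltnNge.
    by rewrite (leq_ltn_trans (rank_leq_col _)).
  by exists v.
have PE : P = plane_of (eta *m (g^T)).
  apply/eqP; rewrite eqEdim [X in (_ <= X)%N]dP dim_plane_of ?leqnn ?andbT.
    apply/subvP => v /(memv_basis_mx _ dP)[s ->].
    have Neta : N *m eta^T = 0.
      by apply: trmx_inj; rewrite trmx_mul trmxK trmx0.
    by rewrite mem_plane trmx_mul trmxK -!mulmxA (mulmxA B) Neta mulmx0.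
  apply: contraNneq eta0 => e0; rewrite -[eta](@mulmxK _ _ _ g^T) ?unitmx_tr //.
  by rewrite e0 mul0mx.
have tg : tangent_plane eta.
  move=> x y xe ye.
  have inP (z : 'rV_4) : z *m eta^T = 0 -> exists s, s *m N = z.
    move=> z0; have : z *m invmx g \in P.
      by rewrite PE mem_plane trmx_mul trmxK mulmxA mulmxKV // z0.
    move=> /(memv_basis_mx _ dP)[s sE]; exists s.
    by rewrite /N mulmxA -sE mulmxKV.
  have [s <-] := inP x xe; have [t <-] := inP y ye.
  exact: (polar4_eq0 k2 D0).
have [i ei] : exists i, eta 0 i != 0.
  apply/existsP; apply: contraNT eta0; rewrite negb_exists => /forallP e0.
  by apply/eqP/rowP => i; rewrite mxE; apply/eqP/negbNE/e0.
exists i; apply/eqP; rewrite eqEdim [X in (_ <= X)%N]dP coord_plane_is_plane //.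
rewrite leqnn andbT; apply/subvP => v.
rewrite {1}PE mem_plane mem_coord_plane trmx_mul trmxK mulmxA => /eqP/matrixP.
move=> /(_ 0 0); rewrite mxE (bigD1 i) //= big1 => [|j ji].
  by rewrite addr0 !mxE => /eqP; rewrite mulf_eq0 (negPf ei) orbF.
by rewrite [_^T _ _]mxE (tangent_plane_coord tg ei ji) mulr0.
Qed.

End Tropes.

(** * Bitangent involutions *)

Section Involution.
Context {k : closedFieldType} (k2 : 2%N \in [pchar k]).

(* Up to a factor, (x, y, z, w) |-> (1/y, 1/x, 1/w, 1/z). *)
Definition cremona (x : 'rV[k]_4) : 'rV[k]_4 :=
  row4 (x 0 0 * x 0 2 * x 0 3) (x 0 1 * x 0 2 * x 0 3)
       (x 0 0 * x 0 1 * x 0 2) (x 0 0 * x 0 1 * x 0 3).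

Definition cremona_poly (i : 'I_4) : {mpoly k[4]} :=
  tnth [tuple 'X_0 * 'X_2 * 'X_3; 'X_1 * 'X_2 * 'X_3;
              'X_0 * 'X_1 * 'X_2; 'X_0 * 'X_1 * 'X_3] i.

Definition cremona_involution (g : 'M[k]_4) : 4.-tuple {mpoly k[4]} :=
  [tuple \sum_j invmx g j i *: pullback g (cremona_poly j) | i < 4].

Lemma ratmap_sigma (g : 'M[k]_4) v :
  ratmap (cremona_involution g) v = cremona (v *m g) *m invmx g.
Proof.
have E j : evalv (cremona_poly j) (v *m g) = cremona (v *m g) 0 j.
  move: (v *m g) => x; move: j; apply: forall4P;
  by rewrite row4E /cremona_poly (tnth_nth 0) /= !evalvM /evalv !mevalXU.
apply/rowP => i; rewrite !mxE tnth_mktuple /evalv raddf_sum /=.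
apply: eq_bigr => j _; rewrite mevalZ -/(evalv _ v) evalv_pullback E.
by rewrite mulrC.
Qed.

Lemma sigma_homog (g : 'M[k]_4) i : tnth (cremona_involution g) i \is 3.-homog.
Proof.
have X1 j : ('X_j : {mpoly k[4]}) \is 1.-homog by rewrite dhomogX /= mdeg1.
have X3 i1 i2 i3 : ('X_i1 : {mpoly k[4]}) * 'X_i2 * 'X_i3 \is 3.-homog.
  exact: (dhomogM (dhomogM (X1 i1) (X1 i2)) (X1 i3)).
rewrite tnth_mktuple rpred_sum // => j _; apply: rpredZ.
apply: dhomog_pullback; move: j; apply: forall4P;
  by rewrite /cremona_poly (tnth_nth 0) /=.
Qed.

Lemma cremonaK (x : 'rV[k]_4) :
  cremona (cremona x) = (x 0 0 * x 0 1 * x 0 2 * x 0 3) ^+ 2 *: x.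
Proof.
rewrite /cremona !row4E; apply/rowP; apply: forall4P; rewrite row4E mxE; ring.
Qed.

Lemma kummer_cremona a b c (x : 'rV[k]_4) :
  evalv (kummer_form a b c) (cremona x) =
  (x 0 0 * x 0 1 * x 0 2 * x 0 3) ^+ 2 * evalv (kummer_form a b c) x.
Proof. by rewrite !(evalv_kummer k2) !row4E; ring. Qed.

(** The map scales the block (x, y) by zw and the block (z, w) by xy, so a point moves along its
    line of the congruence; e is the difference of the two scaling factors. *)
Lemma minor6_cremona (x : 'rV[k]_4) (e := x 0 0 * x 0 1 - x 0 2 * x 0 3) :
  minor6 (col_mx x (cremona x)) = e *: Wpsi x.
Proof.
rewrite /minor6 /minor2 !col_mx2E !row4E /Wpsi row6Z /e.
by congr row6; ring.
Qed.

(* On the points (s x, s y, t z, t w) the Kummer form is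
   a (x y)^2 s^4 + (Wmiddle) s^2 t^2 + a (z w)^2 t^4. *)
Definition Wmiddle (b c : k) (x : 'rV[k]_4) : k :=
  b * (x 0 0 * x 0 2 + x 0 1 * x 0 3) ^+ 2
  + c * (x 0 0 * x 0 3 + x 0 1 * x 0 2) ^+ 2
  + x 0 0 * x 0 1 * x 0 2 * x 0 3.

Lemma evalv_kummer_middle a b c (x : 'rV[k]_4) :
  evalv (kummer_form a b c) x =
  a * (x 0 0 * x 0 1 + x 0 2 * x 0 3) ^+ 2 + Wmiddle b c x.
Proof. by rewrite (evalv_kummer k2) /Wmiddle !addrA. Qed.

Lemma kummer_on_cremona_line a b c (x : 'rV[k]_4)
    (e := x 0 0 * x 0 1 - x 0 2 * x 0 3) :
  evalv (kummer_form a b c) x = 0 ->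
  pullback (col_mx x (cremona x) : 'M_(2, 4)) (kummer_form a b c) =
  (a * e ^+ 4) *: ('X_0 ^+ 2 * 'X_1 ^+ 2).
Proof.
rewrite evalv_kummer_middle => K0.
rewrite (pullback_kummer k2) /linf !sum2E !col_mx2E !row4E.
(* Along the line the four coordinates are p A, q A, r B and s B. *)
pose A : {mpoly k[2]} := 'X_0 + (x 0 2 * x 0 3)%:MP * 'X_1.
pose B : {mpoly k[2]} := 'X_0 + (x 0 0 * x 0 1)%:MP * 'X_1.
have E : (a * (x 0 0 * x 0 1 + x 0 2 * x 0 3) ^+ 2 + Wmiddle b c x)%:MP_[2] = 0.
  by rewrite K0.
move: K0 E; rewrite /Wmiddle /e {e}.
move: (x 0 0) (x 0 1) (x 0 2) (x 0 3) @A @B => p q r s A B K0 E.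
have -> : (p *: 'X_0 + (p * r * s) *: 'X_1) = p%:MP * A :> {mpoly k[2]}.
  by rewrite /A -!mul_mpolyC !mpolyCM; ring.
have -> : (q *: 'X_0 + (q * r * s) *: 'X_1) = q%:MP * A :> {mpoly k[2]}.
  by rewrite /A -!mul_mpolyC !mpolyCM; ring.
have -> : (r *: 'X_0 + (p * q * r) *: 'X_1) = r%:MP * B :> {mpoly k[2]}.
  by rewrite /B -!mul_mpolyC !mpolyCM; ring.
have -> : (s *: 'X_0 + (p * q * s) *: 'X_1) = s%:MP * B :> {mpoly k[2]}.
  by rewrite /B -!mul_mpolyC !mpolyCM; ring.
(* V is chosen so that, after squaring, the coefficient of (A B)^2 is the value of the Kummer form
   at x, which is zero; only a U^2 is left. *)
pose V : {mpoly k[2]} := (p * q + r * s)%:MP * (A * B).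
pose U : {mpoly k[2]} := - ((p * q - r * s) ^+ 2)%:MP * ('X_0 * 'X_1).
have -> : p%:MP * A * (q%:MP * A) + r%:MP * B * (s%:MP * B) = V + U.
  by rewrite /U /V /A /B !(mpolyCD, mpolyCM, mpolyCN, mpolyCB, rmorphXn) /=; ring.
rewrite (sqrrD_char2 (mpoly_char2 k2 2)).
transitivity ((a * (p * q + r * s) ^+ 2 +
  (b * (p * r + q * s) ^+ 2 + c * (p * s + q * r) ^+ 2 + p * q * r * s))%:MP
  * (A * B) ^+ 2 + a *: U ^+ 2).
  by rewrite /V -!mul_mpolyC !(mpolyCD, mpolyCM, rmorphXn) /=; ring.
rewrite E mul0r add0r /U -!mul_mpolyC !(mpolyCD, mpolyCM, mpolyCN, rmorphXn) /=.
ring.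
Qed.

(** This point shows that the open conditions used for the involution are nonempty on X. *)
Lemma kummer_point (a b c : k) : a != 0 -> b != 0 -> c != 0 ->
  exists x : 'rV[k]_4, [/\ evalv (kummer_form a b c) x = 0,
    forall i, x 0 i != 0 & x 0 0 * x 0 1 - x 0 2 * x 0 3 != 0].
Proof.
move=> a0 b0 c0.
(* At (1, y, z, 1) the form is P1(z) y^2 + z y + P2(z). Nonzero P1 and P2 make the projective root
   finite and nonzero, and P3(z) is the value at y = z in characteristic 2, so P3 keeps y apart from
   z. *)
pose P1 : {poly k} := (a + b)%:P + c *: 'X^2.
pose P2 : {poly k} := (a + b) *: 'X^2 + c%:P.
pose P3 : {poly k} := c *: 'X^4 + 'X^2 + c%:P.
have P10 : P1 != 0.
  apply: contraNneq c0 => /(congr1 (fun p : {poly k} => p`_2)).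
  by rewrite coefD coefZ coefXn coefC coef0 /= mulr1 add0r => ->.
have P20 : P2 != 0.
  apply: contraNneq c0 => /(congr1 (fun p : {poly k} => p`_0)).
  by rewrite coefD coefZ coefXn coefC coef0 /= mulr0 add0r => ->.
have P30 : P3 != 0.
  apply: contraNneq c0 => /(congr1 (fun p : {poly k} => p`_0)).
  by rewrite !coefD coefZ !coefXn coefC coef0 /= mulr0 !add0r => ->.
have X0 : 'X != 0 :> {poly k} by rewrite polyX_eq0.
have [z] := closed_nonrootP ('X * P1 * P2 * P3)
  (mulf_neq0 (mulf_neq0 (mulf_neq0 X0 P10) P20) P30).
rewrite rootE !hornerM !mulf_eq0 !negb_or hornerX.
rewrite !(hornerD, hornerZ, hornerXn, hornerC) => /andP[/andP[/andP[z0 z1] z2] z3].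
have [s [t [st E]]] := quadratic_zero (a + b + c * z ^+ 2) z ((a + b) * z ^+ 2 + c).
have t0 : t != 0.
  apply: contraTneq st => t0; move: E.
  rewrite t0 mulr0 expr0n !mulr0 !addr0 => /eqP.
  by rewrite mulf_eq0 (negPf z1) expf_eq0 /= => ->; rewrite eqxx.
have s0 : s != 0.
  apply: contraTneq st => s0; move: E.
  rewrite s0 mul0r expr0n !mulr0 !add0r => /eqP.
  by rewrite mulf_eq0 (negPf z2) expf_eq0 /= => ->; rewrite eqxx.
pose y := s / t.
have Ey : (a + b + c * z ^+ 2) * y ^+ 2 + z * y + ((a + b) * z ^+ 2 + c) = 0.
  apply: (mulfI (expf_neq0 2 t0)); rewrite mulr0 -[RHS]E /y; field; exact: t0.
have dbl (u : k) : u *+ 2 = 0 by rewrite mulr2n addrr_pchar2.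
exists (row4 1 y z 1); split.
- rewrite (evalv_kummer k2) !row4E !(sqrrD_char2 k2) -[RHS]Ey; ring.
- by apply: forall4P; rewrite row4E ?oner_eq0 // /y mulf_neq0 // invr_eq0.
- rewrite !row4E mul1r mulr1 subr_eq0; apply: contra z3 => /eqP yz.
  rewrite -Ey yz.
  apply/eqP; transitivity (c * z ^+ 4 + z ^+ 2 + c + (z ^+ 2 * (a + b)) *+ 2).
    by rewrite dbl addr0.
  ring.
Qed.

Lemma sigma_bitangent_involution (g : 'M[k]_4) a b c : g \in unitmx ->
  a != 0 -> b != 0 -> c != 0 ->
  bitangent_involution (pullback g (kummer_form a b c)) (cremona_involution g).
Proof.
move=> gu a0 b0 c0; split; first by exists 3%N; exact: sigma_homog.
(* Nonzero xyzw makes the map an involution at the point, and nonzero xy - zw keeps the point and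
   its image independent. *)
pose G : {mpoly k[4]} :=
  'X_0 * 'X_1 * 'X_2 * 'X_3 * ('X_0 * 'X_1 - 'X_2 * 'X_3).
have GE v : evalv (pullback g G) v = (v *m g) 0 0 * (v *m g) 0 1 * (v *m g) 0 2
    * (v *m g) 0 3 * ((v *m g) 0 0 * (v *m g) 0 1 - (v *m g) 0 2 * (v *m g) 0 3).
  by rewrite evalv_pullback /evalv !meval_simpl.
exists 6%N, (pullback g G); split.
- have X1 j : ('X_j : {mpoly k[4]}) \is 1.-homog by rewrite dhomogX /= mdeg1.
  have X2 i j : ('X_i : {mpoly k[4]}) * 'X_j \is 2.-homog.
    exact: (dhomogM (X1 i) (X1 j)).
  apply: dhomog_pullback.
  have X4 := dhomogM (dhomogM (X2 0 1) (X1 2)) (X1 3).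
  exact: (dhomogM X4 (rpredB (X2 0 1) (X2 2 3))).
- have [x [Kx x0 ex]] := kummer_point a0 b0 c0.
  exists (x *m invmx g); split.
  + apply: contraNneq (x0 0) => E.
    by rewrite -[x](mulmxKV gu) E mul0mx mxE.
  + by rewrite evalv_pullback mulmxKV.
  + by rewrite GE mulmxKV // !mulf_neq0.
move=> v _; rewrite evalv_pullback GE ratmap_sigma => Kx.
rewrite !mulf_eq0 !negb_or => /andP[/andP[/andP[/andP[x0 x1] x2] x3] ex].
have vE : v = (v *m g) *m invmx g by rewrite mulmxK.
move: (v *m g) vE Kx x0 x1 x2 x3 ex => x -> Kx x0 x1 x2 x3 ex /=.
split.
- by rewrite evalv_pullback mulmxKV // kummer_cremona Kx mulr0.
- exists ((x 0 0 * x 0 1 * x 0 2 * x 0 3) ^+ 2).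
    by rewrite expf_neq0 // !mulf_neq0.
  by rewrite ratmap_sigma mulmxKV // cremonaK scalemxAl.
- apply: free_mulmx; rewrite ?unitmx_inv //; apply/free_minor6.
  by rewrite minor6_cremona scaler_eq0 negb_or ex Wpsi_neq0 x0 x2.
- exists ((a * (x 0 0 * x 0 1 - x 0 2 * x 0 3) ^+ 4)%:MP).
  rewrite pullbackM (@mul_col_mx _ 1 1) !mulmxKV //.
  rewrite kummer_on_cremona_line // /point_form !mxE /= !scale1r !scale0r.
  by rewrite subr0 sub0r -mul_mpolyC; ring.
Qed.

(** Every secant has a Plücker vector proportional to a value of [Wpsi], hence lies in [Wlines g].
    Conversely, a form nonzero at some line of [Wlines g] is nonzero at a general one, and a general
    one is the secant through one of its points on X. *)
Lemma involution_surface_sigma (g : 'M[k]_4) a b c : g \in unitmx ->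
  a != 0 -> b != 0 -> c != 0 ->
  same_lines (Wlines g)
    (involution_surface (pullback g (kummer_form a b c)) (cremona_involution g)).
Proof.
move=> gu a0 b0 c0 L.
have spanW v : free [:: v; ratmap (cremona_involution g) v] ->
    Wlines g <<[:: v; ratmap (cremona_involution g) v]>>%VS.
  move=> fr; have := fr; have := span_minor6_coordL g fr.
  rewrite {1}ratmap_sigma mulmxKV // minor6_cremona row6Z.
  move=> [d d0]; rewrite row6Z => /row6_inj[[p01 _ _] [_ _ p23]] _.
  split; first exact: is_line_span.
    by apply: (mulfI d0); rewrite mulr0 -p01 mulr0.
  by apply: (mulfI d0); rewrite mulr0 -p23 mulr0.
split; last first.
  move=> [dL]; apply; first exact: closed_Wlines.
  by move=> L' _ [v [_ fr ->]]; exact: spanW.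
move=> WL; split; first by case: WL.
move=> Z [S [hS ZE]] AZ; apply/ZE; split; first by case: WL.
move=> f Sf; apply: NNPP => /eqP fL; have [d hf] := hS f Sf.
have /(WlinesP _ gu)[t0 psi0 LE] := WL.
have [_ [d0 dn0 dE]] := Wlines_Wline gu psi0.
rewrite -LE in dE; rewrite -(evalv_plucker_coordL gu hf dn0 dE) in fL.
have [x [Kx x0 ex]] := kummer_point a0 b0 c0.
(* On X, [Wmiddle] = 0 would give xy + zw = 0, which in characteristic 2 is the excluded xy - zw =
   0. *)
have mid0 : x 0 0 * x 0 1 * x 0 2 * x 0 3 * Wmiddle b c x != 0.
  rewrite !mulf_neq0 //; apply: contraNneq ex => m0.
  move: Kx; rewrite evalv_kummer_middle m0 addr0 => /eqP.
  by rewrite mulf_eq0 (negPf a0) expf_eq0 /= (GRing.subr_pchar2 k2).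
have pm : polyfun (fun t : 'rV[k]_4 =>
    t 0 0 * t 0 1 * t 0 2 * t 0 3 * Wmiddle b c t).
  rewrite /Wmiddle.
  by do !(exact: polyfun_coord || exact: polyfun_const || apply: polyfunM ||
    apply: polyfunD).
have [t [ft]] := polyfun_meet (polyfun_evalv_wedge g f polyfun_Wpsi) pm fL mid0.
rewrite !mulf_eq0 !negb_or => /andP[/andP[/andP[/andP[y0 y1] y2] y3] m0].
(* The Kummer form at (s' x, s' y, u' z, u' w) is this quadratic in s = s'^2 and u = u'^2. Its outer
   coefficients are nonzero, so neither s nor u vanishes. *)
have [s [u [su E]]] := quadratic_zero (a * (t 0 0 * t 0 1) ^+ 2)
  (Wmiddle b c t) (a * (t 0 2 * t 0 3) ^+ 2).
have u0 : u != 0.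
  apply: contraTneq su => u0; move: E.
  rewrite u0 mulr0 expr0n !mulr0 !addr0 => /eqP.
  by rewrite !(mulf_eq0, expf_eq0) (negPf a0) (negPf y0) (negPf y1) /= orbb => ->;
    rewrite eqxx.
have s0 : s != 0.
  apply: contraTneq su => s0; move: E.
  rewrite s0 mul0r expr0n !mulr0 !add0r => /eqP.
  by rewrite !(mulf_eq0, expf_eq0) (negPf a0) (negPf y2) (negPf y3) /= orbb => ->;
    rewrite eqxx.
have [s' sE] := sqrt_exists s; have [u' uE] := sqrt_exists u.
pose x' := row4 (s' * t 0 0) (s' * t 0 1) (u' * t 0 2) (u' * t 0 3).
have Kx' : evalv (pullback g (kummer_form a b c)) (x' *m invmx g) = 0.
  rewrite evalv_pullback mulmxKV // evalv_kummer_middle (sqrrD_char2 k2).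
  by rewrite /Wmiddle !row4E -[RHS]E -sE -uE /Wmiddle; ring.
(* If this were zero, the outer terms of the quadratic would cancel in characteristic 2, leaving s u
   [Wmiddle] = 0. *)
have ex' : x' 0 0 * x' 0 1 - x' 0 2 * x' 0 3 != 0.
  rewrite !row4E; apply: contraNneq m0 => e0.
  have e1 : s * (t 0 0 * t 0 1) + u * (t 0 2 * t 0 3) = 0.
    by rewrite -(GRing.subr_pchar2 k2) -[RHS]e0 -sE -uE; ring.
  have : s * u * Wmiddle b c t = 0.
    have E2 : (s * (t 0 0 * t 0 1)) ^+ 2 + (u * (t 0 2 * t 0 3)) ^+ 2 = 0.
      by rewrite -(sqrrD_char2 k2) e1 expr0n.
    transitivity (a * (t 0 0 * t 0 1) ^+ 2 * s ^+ 2
      + Wmiddle b c t * (s * u) + a * (t 0 2 * t 0 3) ^+ 2 * u ^+ 2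
      - a * ((s * (t 0 0 * t 0 1)) ^+ 2 + (u * (t 0 2 * t 0 3)) ^+ 2)).
      by ring.
    by rewrite E E2 mulr0 subrr.
  by move=> /eqP; rewrite !mulf_eq0 (negPf s0) (negPf u0).
have s'0 : s' != 0 by apply: contraNneq s0 => z; rewrite -sE z expr0n.
have u'0 : u' != 0 by apply: contraNneq u0 => z; rewrite -uE z expr0n.
have psi' : Wpsi x' = (s' * u') *: Wpsi t.
  by rewrite /Wpsi !row4E row6Z; congr row6; ring.
pose v := x' *m invmx g.
have fr : free [:: v; ratmap (cremona_involution g) v].
  rewrite ratmap_sigma /v mulmxKV //; apply: free_mulmx; rewrite ?unitmx_inv //.
  apply/free_minor6; rewrite minor6_cremona scaler_eq0 negb_or ex' psi'.
  by rewrite scaler_eq0 negb_or mulf_neq0 // Wpsi_neq0 y0 y2.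
have /ZE[_ /(_ f Sf)/eqP] := AZ _ (is_line_span fr) (ex_intro _ v
  (And3 Kx' fr erefl)).
have [q q0] := span_minor6_coordL g fr.
rewrite {1}ratmap_sigma /v !mulmxKV // minor6_cremona psi' scalerA => qE.
have z0 : (x' 0 0 * x' 0 1 - x' 0 2 * x' 0 3) * (s' * u') != 0.
  by rewrite !mulf_neq0.
rewrite -(evalv_plucker_coordL gu hf q0 qE) -scalemxAl.
by rewrite (evalv_homog_eq0 _ hf z0) (negPf ft).
Qed.

End Involution.

Theorem theorem6p5 (k : closedFieldType) (char2 : 2%N \in [pchar k])
    (F : {mpoly k[4]}) (hF : ordinary_kummer_quartic F) :
  bidegree (Bit F) 3 7 /\
  exists comp : 'I_3 + 'I_4 -> lineset,
    [/\ forall Z : lineset, irreducible_component (Bit F) Z <->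
          exists u, same_lines Z (comp u),
        forall u v, same_lines (comp u) (comp v) -> u = v,
        exists sigma : 'I_3 -> 4.-tuple {mpoly k[4]}, forall i,
          [/\ bitangent_involution F (sigma i),
              same_lines (comp (inl i)) (involution_surface F (sigma i))
            & bidegree (comp (inl i)) 1 1]
      & exists T : 'I_4 -> {vspace 'rV[k]_4},
          [/\ injective T,
              forall P, trope F P <-> exists j, P = T j
            & forall j, same_lines (comp (inr j)) (beta_plane (T j)) /\
                        bidegree (comp (inr j)) 0 1]].
Proof.
have [a [b [c [g [a0 b0 c0 gu FE]]]]] := hF.
(* An equality of line sets, not just an equivalence, allows rewriting inside [bidegree] and
   [irreducible_component]. *)
have BitE : Bit F = fun L => exists u, bitcomp g u L.
  apply: functional_extensionality => L; apply: propositional_extensionality.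
  by rewrite FE; exact: Bit_bitcomp.
split; first by rewrite BitE; exact: bidegree_bitcomps.
exists (bitcomp g); split.
- apply: irreducible_component_cover.
  + exact: closed_comp.
  + by move=> u; exact: irreducible_bitcomp.
  + by rewrite BitE.
  + by move=> u v; exact: bitcomp_sub_inj.
- by move=> u v uv; apply: (bitcomp_sub_inj gu) => L /uv.
- exists (fun i => cremona_involution (Wframe g i)) => i.
  have [a' [b' [c' [a'0 b'0 c'0 KE]]]] := Wframe_kummer char2 g i a0 b0 c0.
  rewrite FE KE; have giu := Wframe_unit i gu; split.
  + exact: sigma_bitangent_involution.
  + exact: involution_surface_sigma.
  + exact: (bidegree_bitcomp (inl i)).
exists (coord_plane g); split.
- exact: coord_plane_inj.
- move=> P; rewrite FE; split=> [|[j ->]]; first exact: trope_coord_plane.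
  exact: coord_plane_trope.
- move=> j; split; first exact: bitcomp_beta_plane.
  exact: (bidegree_bitcomp (inr j)).
Qed.
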